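(* Let $(\mathcal{T},\varphi)$ be a monoidal monad on a monoidal category $(\mathsf{C},\otimes,I)$. Assume that $\mathsf{C}$ admits reflexive coequalizers and that both $\otimes$ and $\mathcal{T}$ preserve such coequalizers. Then the normal colax monoidal structure $\underline{\otimes}^{\varphi}$ on $\mathsf{C}^{\mathcal{T}}$, defined by universal $\mathcal{T}$-multilinear maps, is in fact monoidal.
   Context: Monoidal categories are treated as if strict. A reflexive coequalizer is a coequalizer of a pair of maps with a common section. A monad $(\mathcal{T},\mu,\eta)$ on $(\mathsf{C},\otimes,I)$ is *monoidal* if $\mathcal{T}$ carries a lax monoidal structure $\varphi_{X,Y}:\mathcal{T}X\otimes\mathcal{T}Y\to\mathcal{T}(X\otimes Y)$, $\varphi_0:I\to\mathcal{T}I$ for which $\mu$ and $\eta$ are morphisms of monoidal functors. Iterating gives $\varphi_{X_1,\dots,X_n}:\mathcal{T}X_1\otimes\cdots\otimes\mathcal{T}X_n\to\mathcal{T}(X_1\otimes\cdots\otimes X_n)$ (the identity if $n=1$, $\varphi_0$ if $n=0$). $\mathsf{C}^{\mathcal{T}}$ is the category of $\mathcal{T}$-algebras. For $\mathcal{T}$-algebras $(V_i,v_i)$, $i=1,\dots,n$, and $(W,w)$, a map $f:V_1\otimes\cdots\otimes V_n\to W$ in $\mathsf{C}$ is *$\mathcal{T}$-multilinear* if $w\circ\mathcal{T}f\circ\varphi_{V_1,\dots,V_n}=f\circ(v_1\otimes\cdots\otimes v_n)$. A multilinear map $u:V_1\otimes\cdots\otimes V_n\to U$ is *universal* if every multilinear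 map $f:V_1\otimes\cdots\otimes V_n\to W$ factors as $f=\hat f\circ u$ for a unique morphism of algebras $\hat f:U\to W$. A *colax monoidal structure* on a category $\mathsf{D}$ consists of functors $\otimes^n:\mathsf{D}^n\to\mathsf{D}$ ($n\ge0$), a natural transformation $\epsilon:\otimes^1\to\mathrm{id}$ and natural transformations $\alpha^{m_1,\dots,m_n}:\otimes^{m_1+\cdots+m_n}(\underline{X})\to\otimes^n(\otimes^{m_1}(\underline{X}^1),\dots,\otimes^{m_n}(\underline{X}^n))$, where $\underline{X}$ is the concatenation of the sequences $\underline{X}^i$ of length $m_i$, satisfying coassociativity (the two induced maps to any threefold nested tensor product agree) and counitality ($\epsilon\circ\alpha^{n}=\mathrm{id}$ and $\otimes^n(\epsilon,\dots,\epsilon)\circ\alpha^{1,\dots,1}=\mathrm{id}$). It is *normal* if $\epsilon$ is invertible, and it is monoidal if $\epsilon$ and all $\alpha^{m_1,\dots,m_n}$ are invertible. Under the hypotheses on reflexive coequalizers, universal multilinear maps $u_{V_1,\dots,V_n}$ exist for every sequence of algebras: the algebra morphism $\mathcal{T}(V_1\otimes\cdots\otimes V_n)\to U$ corresponding to $u$ is the coequalizer in $\mathsf{C}^{\mathcal{T}}$ of $\mu\circ\mathcal{T}\varphi$ and $\mathcal{T}(v_1\otimes\cdots\otimes v_n):\mathcal{T}(\mathcal{T}V_1\otimes\cdots\otimes\mathcal{T}V_n)\to\mathcal{T}(V_1\otimes\cdots\otimes V_n)$. The structure $\underline{\otimes}^{\varphi}$ is as follows: $\otimes^{\varphi,n}(V_1,\dots,V_n)$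 is the codomain of $u_{V_1,\dots,V_n}$; $\epsilon_V$ is the unique algebra morphism with $\epsilon_V\circ u_V=\mathrm{id}_V$; and $\alpha^{m_1,\dots,m_n}$ is the unique algebra morphism whose composite with the universal multilinear map of the concatenated sequence equals $u\circ(u\otimes\cdots\otimes u)$, where the inner $u$'s are the universal maps of the individual sequences and the outer $u$ is that of the sequence of their codomains. *)

(* Defs.v *)
From mathcomp Require Import all_boot.
From mathcomp Require Import boolp.

Set Implicit Arguments.
Unset Strict Implicit.
Unset Printing Implicit Defensive.

Declare Scope cat_scope.
Delimit Scope cat_scope with cat.
Local Open Scope cat_scope.

Record category := Category {
  obj :> Type;
  hom : obj -> obj -> Type;
  id1 : forall X, hom X X;
  comp : forall X Y Z, hom Y Z -> hom X Y -> hom X Z;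
  comp_idl : forall X Y (f : hom X Y), comp (id1 Y) f = f;
  comp_idr : forall X Y (f : hom X Y), comp f (id1 X) = f;
  compA : forall W X Y Z (f : hom Y Z) (g : hom X Y) (h : hom W X),
    comp f (comp g h) = comp (comp f g) h
}.
Arguments hom {c} X Y.
Arguments id1 {c} X.
Arguments comp {c X Y Z} g f.
Notation "g ∘ f" := (comp g f) (at level 40, left associativity) : cat_scope.

Definition is_iso (C : category) (X Y : C) (f : hom X Y) : Prop :=
  exists g : hom Y X, g ∘ f = id1 X /\ f ∘ g = id1 Y.

Record iso (C : category) (X Y : C) := Iso {
  fwd : hom X Y;
  bwd : hom Y X;
  bwdK : bwd ∘ fwd = id1 X;
  fwdK : fwd ∘ bwd = id1 Y
}.

Definition eq_hom (C : category) (X Y : C) (e : X = Y) : hom X Y :=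
  match e in _ = Y' return hom X Y' with erefl => id1 X end.

Record functor (C D : category) := Functor {
  fobj :> C -> D;
  fmap : forall X Y, hom X Y -> hom (fobj X) (fobj Y);
  fmap_id : forall X, fmap (id1 X) = id1 (fobj X);
  fmap_comp : forall X Y Z (g : hom Y Z) (f : hom X Y),
    fmap (g ∘ f) = fmap g ∘ fmap f
}.
Arguments fmap {C D} F {X Y} _ : rename.

Section Product.
Variables C D : category.
Let phom (X Y : C * D) : Type := (hom X.1 Y.1 * hom X.2 Y.2)%type.
Let pid (X : C * D) : phom X X := (id1 X.1, id1 X.2).
Let pcomp (X Y Z : C * D) (g : phom Y Z) (f : phom X Y) : phom X Z :=
  (g.1 ∘ f.1, g.2 ∘ f.2).
Let pidl X Y (f : phom X Y) : pcomp (pid Y) f = f.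
Proof. by case: f => f1 f2; rewrite /pcomp /= !comp_idl. Qed.
Let pidr X Y (f : phom X Y) : pcomp f (pid X) = f.
Proof. by case: f => f1 f2; rewrite /pcomp /= !comp_idr. Qed.
Let pcA W X Y Z (f : phom Y Z) (g : phom X Y) (h : phom W X) :
  pcomp f (pcomp g h) = pcomp (pcomp f g) h.
Proof. by rewrite /pcomp /= !compA. Qed.
Definition prod_cat : category := Category pidl pidr pcA.
End Product.

Definition is_coequalizer (C : category) (X Y Q : C) (f g : hom X Y)
    (q : hom Y Q) : Prop :=
  q ∘ f = q ∘ g /\
  forall (Z : C) (h : hom Y Z), h ∘ f = h ∘ g -> exists! k : hom Q Z, k ∘ q = h.

Definition reflexive_pair (C : category) (X Y : C) (f g : hom X Y) : Prop :=
  exists s : hom Y X, f ∘ s = id1 Y /\ g ∘ s = id1 Y.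

Definition has_reflexive_coequalizers (C : category) : Prop :=
  forall (X Y : C) (f g : hom X Y), reflexive_pair f g ->
    exists (Q : C) (q : hom Y Q), is_coequalizer f g q.

Definition preserves_reflexive_coequalizers (C D : category)
    (F : functor C D) : Prop :=
  forall (X Y Q : C) (f g : hom X Y) (q : hom Y Q),
    reflexive_pair f g -> is_coequalizer f g q ->
    is_coequalizer (fmap F f) (fmap F g) (fmap F q).

(* Sequences of the same length, related componentwise (by data). *)
Fixpoint pointwise (A B : Type) (R : A -> B -> Type) (s : seq A) (t : seq B) :
    Type :=
  match s, t with
  | [::], [::] => unit
  | a :: s', b :: t' => (R a b * pointwise R s' t')%type
  | _, _ => void
  end.

Section Pointwise.
Variables A B : Type.
Implicit Types (s : seq A) (t : seq B).

Fixpoint pw_diag (R : A -> A -> Type) (f : forall a, R a a) s :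
    pointwise R s s :=
  match s with [::] => tt | a :: s' => (f a, pw_diag f s') end.

Fixpoint pw_graph (R : A -> B -> Type) (h : A -> B) (f : forall a, R a (h a))
    s : pointwise R s (map h s) :=
  match s with [::] => tt | a :: s' => (f a, pw_graph f s') end.

Fixpoint pw_map (R R' : A -> B -> Type) (f : forall a b, R a b -> R' a b) s t :
    pointwise R s t -> pointwise R' s t :=
  match s, t return pointwise R s t -> pointwise R' s t with
  | [::], [::] => fun=> tt
  | a :: s', b :: t' => fun r => (f a b r.1, pw_map f r.2)
  | [::], _ :: _ | _ :: _, [::] => fun r => match r with end
  end.

Fixpoint pw_cat (R : A -> B -> Type) s1 t1 s2 t2 :
    pointwise R s1 t1 -> pointwise R s2 t2 ->
    pointwise R (s1 ++ s2) (t1 ++ t2) :=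
  match s1, t1 return pointwise R s1 t1 -> pointwise R s2 t2 ->
                      pointwise R (s1 ++ s2) (t1 ++ t2) with
  | [::], [::] => fun _ r2 => r2
  | a :: s', b :: t' => fun r1 r2 => (r1.1, pw_cat r1.2 r2)
  | [::], _ :: _ | _ :: _, [::] => fun r _ => match r with end
  end.

Fixpoint pw_flatten (R : A -> B -> Type) (ss : seq (seq A)) (tt : seq (seq B)) :
    pointwise (pointwise R) ss tt -> pointwise R (flatten ss) (flatten tt) :=
  match ss, tt return pointwise (pointwise R) ss tt ->
                      pointwise R (flatten ss) (flatten tt) with
  | [::], [::] => id
  | s :: ss', t :: tt' => fun r => pw_cat r.1 (pw_flatten r.2)
  | [::], _ :: _ | _ :: _, [::] => fun r => match r with end
  end.

(* [pw_image] differs from [pw_map] in that it also maps the sequences. *)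
Fixpoint pw_image (A' B' : Type) (R : A -> B -> Type) (R' : A' -> B' -> Type)
    (h : A -> A') (k : B -> B') (f : forall a b, R a b -> R' (h a) (k b)) s t :
    pointwise R s t -> pointwise R' (map h s) (map k t) :=
  match s, t return pointwise R s t -> pointwise R' (map h s) (map k t) with
  | [::], [::] => fun=> tt
  | a :: s', b :: t' => fun r => (f a b r.1, pw_image f r.2)
  | [::], _ :: _ | _ :: _, [::] => fun r => match r with end
  end.
End Pointwise.

Fixpoint pw_comp (A B D : Type) (R1 : A -> B -> Type) (R2 : B -> D -> Type)
    (R3 : A -> D -> Type) (f : forall a b d, R2 b d -> R1 a b -> R3 a d)
    (s : seq A) (t : seq B) (u : seq D) :
    pointwise R2 t u -> pointwise R1 s t -> pointwise R3 s u :=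
  match s, t, u return pointwise R2 t u -> pointwise R1 s t ->
                       pointwise R3 s u with
  | [::], [::], [::] => fun _ _ => tt
  | a :: s', b :: t', d :: u' =>
      fun r2 r1 => (f a b d r2.1 r1.1, pw_comp f r2.2 r1.2)
  | [::], _ :: _, _ | _ :: _, [::], _ => fun _ r => match r with end
  | _, [::], _ :: _ | _, _ :: _, [::] => fun r _ => match r with end
  end.

Arguments pw_map {A B R R'} f {s t} _.
Arguments pw_cat {A B R s1 t1 s2 t2} _ _.
Arguments pw_flatten {A B R ss tt} _.
Arguments pw_image {A B A' B' R R' h k} f {s t} _.
Arguments pw_comp {A B D R1 R2 R3} f {s t u} _ _.

(* The disjoint union over n of the n-fold powers of D: a functor out of it is
   a family of functors from the powers D^n, for all n. *)
Section SeqCat.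
Variable D : category.
Let shom (s t : seq D) : Type := pointwise (@hom D) s t.
Let sid (s : seq D) : shom s s := pw_diag (@id1 D) s.
Let scomp (s t u : seq D) : shom t u -> shom s t -> shom s u :=
  pw_comp (fun a b d => @comp D a b d).
Let sidl s t (f : shom s t) : scomp (sid t) f = f.
Proof.
elim: s t f => [|a s IH] [|b t] //= => [[]|[f fs]] //.
by congr (_, _); [exact: comp_idl|exact: IH].
Qed.
Let sidr s t (f : shom s t) : scomp f (sid s) = f.
Proof.
elim: s t f => [|a s IH] [|b t] //= => [[]|[f fs]] //.
by congr (_, _); [exact: comp_idr|exact: IH].
Qed.
Let scA r s t u (f : shom t u) (g : shom s t) (h : shom r s) :
  scomp f (scomp g h) = scomp (scomp f g) h.
Proof.
elim: r s t u f g h => [|a r IH] [|b s] [|c t] [|d u] //=.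
by move=> [f fs] [g gs] [h hs] /=; congr (_, _); [exact: compA|exact: IH].
Qed.
Definition seq_cat : category := Category sidl sidr scA.
End SeqCat.

Lemma flatten_flatten (A : Type) (sss : seq (seq (seq A))) :
  flatten (flatten sss) = flatten (map flatten sss).
Proof. by elim: sss => //= ss sss <-; rewrite flatten_cat. Qed.

Lemma flatten_single (A : Type) (s : seq A) :
  s = flatten [seq [:: x] | x <- s].
Proof. by rewrite flatten_seq1. Qed.

Lemma flatten_singleton (A : Type) (s : seq A) : s = flatten [:: s].
Proof. by rewrite /= cats0. Qed.

Section NestedSequences.
Variables (D : category) (ten : seq D -> D).

Fixpoint epsilon_seq (epsilon : forall X : D, hom (ten [:: X]) X) (Xs : seq D) :
    @hom (seq_cat D) (map ten [seq [:: X] | X <- Xs]) Xs :=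
  match Xs with
  | [::] => tt
  | X :: Xs' => (epsilon X, epsilon_seq epsilon Xs')
  end.

Fixpoint alpha_seq
    (alpha : forall Xss : seq (seq D), hom (ten (flatten Xss)) (ten (map ten Xss)))
    (Xsss : seq (seq (seq D))) :
    @hom (seq_cat D) (map ten (map flatten Xsss)) (map ten (map (map ten) Xsss)) :=
  match Xsss with
  | [::] => tt
  | Xss :: Xsss' => (alpha Xss, alpha_seq alpha Xsss')
  end.
End NestedSequences.

(* The n-fold tensor product is [otimes] on sequences of length n, and the
   superscript of [alpha Xss] consists of the lengths of the members of [Xss].
   [eq_hom] only identifies sequences that are equal but not convertible. *)
Record colax_monoidal (D : category) := ColaxMonoidal {
  otimes : functor (seq_cat D) D;
  epsilon : forall X : D, hom (otimes [:: X]) X;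
  epsilon_nat : forall (X Y : D) (f : hom X Y),
    epsilon Y ∘ fmap otimes ((f, tt) : @hom (seq_cat D) [:: X] [:: Y])
    = f ∘ epsilon X;
  alpha : forall Xss : seq (seq D),
    hom (otimes (flatten Xss)) (otimes (map otimes Xss));
  alpha_nat : forall (Xss Yss : seq (seq D))
      (fss : @hom (seq_cat (seq_cat D)) Xss Yss),
    alpha Yss ∘ fmap otimes
      (pw_flatten fss : @hom (seq_cat D) (flatten Xss) (flatten Yss))
    = fmap otimes
      (pw_image (@fmap _ _ otimes) fss
        : @hom (seq_cat D) (map otimes Xss) (map otimes Yss)) ∘ alpha Xss;
  coassoc : forall Xsss : seq (seq (seq D)),
    fmap otimes (alpha_seq alpha Xsss)
    ∘ alpha (map flatten Xsss)
    ∘ fmap otimes (eq_hom (flatten_flatten Xsss : _ = _ :> seq_cat D))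
    = alpha (map (map otimes) Xsss)
    ∘ fmap otimes (eq_hom (map_flatten otimes Xsss : _ = _ :> seq_cat D))
    ∘ alpha (flatten Xsss);
  counitl : forall Xs : seq D,
    epsilon (otimes Xs) ∘ alpha [:: Xs]
    ∘ fmap otimes (eq_hom (flatten_singleton Xs : _ = _ :> seq_cat D))
    = id1 (otimes Xs);
  counitr : forall Xs : seq D,
    fmap otimes (epsilon_seq epsilon Xs) ∘ alpha [seq [:: X] | X <- Xs]
    ∘ fmap otimes (eq_hom (flatten_single Xs : _ = _ :> seq_cat D))
    = id1 (otimes Xs)
}.

Definition is_normal (D : category) (S : colax_monoidal D) : Prop :=
  forall X : D, is_iso (epsilon S X).

Definition is_monoidal (D : category) (S : colax_monoidal D) : Prop :=
  is_normal S /\ forall Xss : seq (seq D), is_iso (alpha S Xss).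

Definition tobj (C : category) (T : functor (prod_cat C C) C) (X Y : C) : C :=
  T (X, Y).
Definition tmap (C : category) (T : functor (prod_cat C C) C)
    (X Y X' Y' : C) (f : hom X X') (g : hom Y Y') :
    hom (tobj T X Y) (tobj T X' Y') :=
  @fmap _ _ T (X, Y) (X', Y') (f, g).

Record monoidal_category := MonoidalCategory {
  mcat :> category;
  tensor : functor (prod_cat mcat mcat) mcat;
  one : mcat;
  asc : forall X Y Z : mcat,
    iso (tobj tensor (tobj tensor X Y) Z) (tobj tensor X (tobj tensor Y Z));
  lun : forall X : mcat, iso (tobj tensor one X) X;
  run : forall X : mcat, iso (tobj tensor X one) X;
  asc_nat : forall (X Y Z X' Y' Z' : mcat)
      (f : hom X X') (g : hom Y Y') (h : hom Z Z'),
    fwd (asc X' Y' Z') ∘ tmap tensor (tmap tensor f g) h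
    = tmap tensor f (tmap tensor g h) ∘ fwd (asc X Y Z);
  lun_nat : forall (X X' : mcat) (f : hom X X'),
    fwd (lun X') ∘ tmap tensor (id1 one) f = f ∘ fwd (lun X);
  run_nat : forall (X X' : mcat) (f : hom X X'),
    fwd (run X') ∘ tmap tensor f (id1 one) = f ∘ fwd (run X);
  triangle : forall X Y : mcat,
    tmap tensor (id1 X) (fwd (lun Y)) ∘ fwd (asc X one Y)
    = tmap tensor (fwd (run X)) (id1 Y);
  pentagon : forall W X Y Z : mcat,
    fwd (asc W X (tobj tensor Y Z)) ∘ fwd (asc (tobj tensor W X) Y Z)
    = tmap tensor (id1 W) (fwd (asc X Y Z)) ∘ fwd (asc W (tobj tensor X Y) Z)
      ∘ tmap tensor (fwd (asc W X Y)) (id1 Z)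
}.
Arguments one {m}.
Arguments asc {m} X Y Z.
Arguments lun {m} X.
Arguments run {m} X.
Notation "X ⊗ Y" := (tobj (tensor _) X Y)
  (at level 38, left associativity) : cat_scope.
Notation "f ⊠ g" := (tmap (tensor _) f g)
  (at level 38, left associativity) : cat_scope.

Section Iterated.
Variable C : monoidal_category.

(* The tensor product of the F a, for a in s, bracketed to the right; it is F a
   itself if s = [:: a]. *)
Fixpoint tens (A : Type) (F : A -> C) (s : seq A) : C :=
  match s with
  | [::] => one
  | a :: s' => match s' with [::] => F a | _ => F a ⊗ tens F s' end
  end.

Definition homs (A B : Type) (F : A -> C) (G : B -> C)
    (s : seq A) (t : seq B) : Type :=
  pointwise (fun a b => hom (F a) (G b)) s t.

Fixpoint tens_map (A B : Type) (F : A -> C) (G : B -> C) (s : seq A) (t : seq B) :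
    homs F G s t -> hom (tens F s) (tens G t) :=
  match s, t return homs F G s t -> hom (tens F s) (tens G t) with
  | [::], [::] => fun=> id1 one
  | a :: s', b :: t' =>
      match s', t' return (homs F G s' t' -> hom (tens F s') (tens G t')) ->
        homs F G (a :: s') (b :: t') ->
        hom (tens F (a :: s')) (tens G (b :: t')) with
      | [::], [::] => fun _ fs => fs.1
      | _ :: _, _ :: _ => fun rec fs => fs.1 ⊠ rec fs.2
      | [::], _ :: _ | _ :: _, [::] => fun _ fs => match fs.2 with end
      end (@tens_map A B F G s' t')
  | [::], _ :: _ | _ :: _, [::] => fun fs => match fs with end
  end.

(* C is not assumed to be strict: [cons_fwd], [cons_bwd], [cat_can] and
   [flatten_can] are the coherence isomorphisms that strictness would turn into
   identities. *)
Section Canonical.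
Variables (A : Type) (F : A -> C).

Definition cons_fwd (a : A) (s : seq A) : hom (tens F (a :: s)) (F a ⊗ tens F s) :=
  match s with [::] => bwd (run (F a)) | _ => id1 _ end.

Definition cons_bwd (a : A) (s : seq A) : hom (F a ⊗ tens F s) (tens F (a :: s)) :=
  match s with [::] => fwd (run (F a)) | _ => id1 _ end.

Fixpoint cat_can (s t : seq A) : hom (tens F (s ++ t)) (tens F s ⊗ tens F t) :=
  match s with
  | [::] => bwd (lun (tens F t))
  | a :: s' => cons_bwd a s' ⊠ id1 (tens F t)
      ∘ bwd (asc (F a) (tens F s') (tens F t))
      ∘ (id1 (F a) ⊠ cat_can s' t) ∘ cons_fwd a (s' ++ t)
  end.
End Canonical.

Fixpoint flatten_can (A : Type) (F : A -> C) (ss : seq (seq A)) :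
    hom (tens F (flatten ss)) (tens (tens F) ss) :=
  match ss with
  | [::] => id1 one
  | s :: ss' => cons_bwd (tens F) s ss'
      ∘ (id1 (tens F s) ⊠ flatten_can F ss') ∘ cat_can F s (flatten ss')
  end.
End Iterated.

Record monad (C : category) := Monad {
  mfun :> functor C C;
  eta : forall X : C, hom X (mfun X);
  mu : forall X : C, hom (mfun (mfun X)) (mfun X);
  eta_nat : forall (X Y : C) (f : hom X Y), eta Y ∘ f = fmap mfun f ∘ eta X;
  mu_nat : forall (X Y : C) (f : hom X Y),
    mu Y ∘ fmap mfun (fmap mfun f) = fmap mfun f ∘ mu X;
  mu_etal : forall X : C, mu X ∘ eta (mfun X) = id1 (mfun X);
  mu_etar : forall X : C, mu X ∘ fmap mfun (eta X) = id1 (mfun X);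
  mu_assoc : forall X : C, mu X ∘ fmap mfun (mu X) = mu X ∘ mu (mfun X)
}.

Record monoidal_monad (C : monoidal_category) := MonoidalMonad {
  mmonad :> monad C;
  phi : forall X Y : C, hom (mmonad X ⊗ mmonad Y) (mmonad (X ⊗ Y));
  phi0 : hom one (mmonad (@one C));
  phi_nat : forall (X X' Y Y' : C) (f : hom X X') (g : hom Y Y'),
    phi X' Y' ∘ (fmap mmonad f ⊠ fmap mmonad g) = fmap mmonad (f ⊠ g) ∘ phi X Y;
  phi_asc : forall X Y Z : C,
    fmap mmonad (fwd (asc X Y Z)) ∘ phi (X ⊗ Y) Z ∘ (phi X Y ⊠ id1 (mmonad Z))
    = phi X (Y ⊗ Z) ∘ (id1 (mmonad X) ⊠ phi Y Z)
      ∘ fwd (asc (mmonad X) (mmonad Y) (mmonad Z));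
  phi_lun : forall X : C,
    fmap mmonad (fwd (lun X)) ∘ phi one X ∘ (phi0 ⊠ id1 (mmonad X))
    = fwd (lun (mmonad X));
  phi_run : forall X : C,
    fmap mmonad (fwd (run X)) ∘ phi X one ∘ (id1 (mmonad X) ⊠ phi0)
    = fwd (run (mmonad X));
  eta_phi : forall X Y : C,
    phi X Y ∘ (eta mmonad X ⊠ eta mmonad Y) = eta mmonad (X ⊗ Y);
  eta_phi0 : phi0 = eta mmonad one;
  mu_phi : forall X Y : C,
    phi X Y ∘ (mu mmonad X ⊠ mu mmonad Y)
    = mu mmonad (X ⊗ Y) ∘ fmap mmonad (phi X Y)
      ∘ phi (mmonad X) (mmonad Y);
  mu_phi0 : phi0 = mu mmonad one ∘ fmap mmonad phi0 ∘ phi0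
}.

Fixpoint phis (C : monoidal_category) (T : monoidal_monad C) (A : Type)
    (F : A -> C) (s : seq A) : hom (tens (fun a => T (F a)) s) (T (tens F s)) :=
  match s with
  | [::] => phi0 T
  | a :: s' =>
      match s' return
        hom (tens (fun a => T (F a)) s') (T (tens F s')) ->
        hom (tens (fun a => T (F a)) (a :: s')) (T (tens F (a :: s'))) with
      | [::] => fun=> id1 _
      | b :: s'' => fun r =>
          phi T (F a) (tens F (b :: s'')) ∘ (id1 (T (F a)) ⊠ r)
      end (phis T F s')
  end.

Section Algebras.
Variables (C : category) (T : monad C).

Record algebra := Algebra {
  car : C;
  str : hom (T car) car;
  str_eta : str ∘ eta T car = id1 car;
  str_mu : str ∘ fmap T str = str ∘ mu T car
}.

Record alg_hom (V W : algebra) := AlgHom {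
  map_of : hom (car V) (car W);
  map_ofP : map_of ∘ str V = str W ∘ fmap T map_of
}.

Lemma alg_hom_inj (V W : algebra) (f g : alg_hom V W) :
  map_of f = map_of g -> f = g.
Proof.
case: f g => [f fP] [g gP] /= e; subst g.
by congr AlgHom; apply: Prop_irrelevance.
Qed.

Let aid (V : algebra) : alg_hom V V.
Proof.
by exists (id1 (car V)); rewrite comp_idl fmap_id comp_idr.
Defined.

Let acomp (V W U : algebra) (g : alg_hom W U) (f : alg_hom V W) : alg_hom V U.
Proof.
exists (map_of g ∘ map_of f).
by rewrite -compA map_ofP compA map_ofP -compA -fmap_comp.
Defined.

Let aidl V W (f : alg_hom V W) : acomp (aid W) f = f.
Proof. by apply: alg_hom_inj; rewrite /= comp_idl. Qed.
Let aidr V W (f : alg_hom V W) : acomp f (aid V) = f.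
Proof. by apply: alg_hom_inj; rewrite /= comp_idr. Qed.
Let acA U V W Z (f : alg_hom W Z) (g : alg_hom V W) (h : alg_hom U V) :
  acomp f (acomp g h) = acomp (acomp f g) h.
Proof. by apply: alg_hom_inj; rewrite /= compA. Qed.

Definition alg_cat : category := Category aidl aidr acA.
End Algebras.

Section Multilinear.
Variables (C : monoidal_category) (T : monoidal_monad C).
Local Notation alg := (alg_cat T).

Definition strs (Vs : seq alg) : homs (fun V => T (car V)) (@car _ T) Vs Vs :=
  pw_diag (@str _ T) Vs.

Definition multilinear (Vs : seq alg) (W : alg)
    (f : hom (tens (@car _ T) Vs) (car W)) : Prop :=
  str W ∘ fmap T f ∘ phis T (@car _ T) Vs = f ∘ tens_map (strs Vs).

Definition universal (Vs : seq alg) (U : alg)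
    (u : hom (tens (@car _ T) Vs) (car U)) : Prop :=
  multilinear u /\
  forall (W : alg) (f : hom (tens (@car _ T) Vs) (car W)), multilinear f ->
    exists! g : hom U W, f = map_of g ∘ u.

Record universal_choice := UniversalChoice {
  uobj : seq alg -> alg;
  umap : forall Vs : seq alg, hom (tens (@car _ T) Vs) (car (uobj Vs));
  umapP : forall Vs : seq alg, universal (umap Vs)
}.
End Multilinear.

Fixpoint pw_cograph A B (R : A -> B -> Type) (h : B -> A) (f : forall b, R (h b) b)
    (s : seq B) : pointwise R (map h s) s :=
  match s with [::] => tt | b :: s' => (f b, pw_cograph f s') end.

Lemma comp_reA (C : category) (V X X' Y Z : C) (f : hom X Z) (g : hom Y X)
    (f' : hom X' Z) (g' : hom Y X') (h : hom V Y) :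
  f ∘ g = f' ∘ g' -> f ∘ (g ∘ h) = f' ∘ (g' ∘ h).
Proof. by move=> e; rewrite !compA e. Qed.

Lemma comp_reA1 (C : category) (V X Y Z : C) (f : hom X Z) (g : hom Y X)
    (k : hom Y Z) (h : hom V Y) : f ∘ g = k -> f ∘ (g ∘ h) = k ∘ h.
Proof. by move=> e; rewrite !compA e. Qed.

Lemma iso_epi (C : category) (X Y Z : C) (a : iso X Y) (f g : hom Y Z) :
  f ∘ fwd a = g ∘ fwd a -> f = g.
Proof. by move=> e; rewrite -[f]comp_idr -(fwdK a) compA e -compA fwdK comp_idr. Qed.

Lemma iso_mono (C : category) (X Y Z : C) (a : iso X Y) (f g : hom Z X) :
  fwd a ∘ f = fwd a ∘ g -> f = g.
Proof. by move=> e; rewrite -[f]comp_idl -(bwdK a) -compA e compA bwdK comp_idl. Qed.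

Lemma iso_sq (C : category) (X Y X' Y' : C) (a : iso X Y) (b : iso X' Y')
    (f : hom X X') (g : hom Y Y') :
  fwd b ∘ f = g ∘ fwd a -> bwd b ∘ g = f ∘ bwd a.
Proof.
move=> e; apply: (iso_mono (a := b)); apply: (iso_epi (a := a)).
by rewrite !compA fwdK comp_idl -compA bwdK comp_idr.
Qed.

Section Coherence.
Variable C : monoidal_category.
Implicit Types X Y Z W : C.

Lemma tmap_id X Y : id1 X ⊠ id1 Y = id1 (X ⊗ Y).
Proof. exact: (fmap_id (tensor C) (X, Y)). Qed.

Lemma tmap_comp X Y Z X' Y' Z' (g : hom Y Z) (f : hom X Y) (g' : hom Y' Z')
    (f' : hom X' Y') : (g ⊠ g') ∘ (f ⊠ f') = (g ∘ f) ⊠ (g' ∘ f').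
Proof.
by symmetry;
  apply: (@fmap_comp _ _ (tensor C) (X, X') (Y, Y') (Z, Z') (g, g') (f, f')).
Qed.

Lemma tmapr_comp W X Y Z (g : hom Y Z) (f : hom X Y) :
  id1 W ⊠ (g ∘ f) = (id1 W ⊠ g) ∘ (id1 W ⊠ f).
Proof. by rewrite tmap_comp comp_idl. Qed.

Lemma tmapl_comp W X Y Z (g : hom Y Z) (f : hom X Y) :
  (g ∘ f) ⊠ id1 W = (g ⊠ id1 W) ∘ (f ⊠ id1 W).
Proof. by rewrite tmap_comp comp_idl. Qed.

Lemma tmap_swap X Y X' Y' (f : hom X Y) (g : hom X' Y') :
  (f ⊠ id1 _) ∘ (id1 _ ⊠ g) = (id1 _ ⊠ g) ∘ (f ⊠ id1 _).
Proof. by rewrite !tmap_comp !comp_idl !comp_idr. Qed.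

Lemma asc_nat' X Y Z X' Y' Z' (f : hom X X') (g : hom Y Y') (h : hom Z Z') :
  bwd (asc X' Y' Z') ∘ (f ⊠ (g ⊠ h)) = (f ⊠ g) ⊠ h ∘ bwd (asc X Y Z).
Proof. by apply: iso_sq; apply: asc_nat. Qed.

Lemma lun_nat' X X' (f : hom X X') :
  bwd (lun X') ∘ f = id1 one ⊠ f ∘ bwd (lun X).
Proof. by apply: iso_sq; apply: lun_nat. Qed.

Lemma run_nat' X X' (f : hom X X') :
  bwd (run X') ∘ f = f ⊠ id1 one ∘ bwd (run X).
Proof. by apply: iso_sq; apply: run_nat. Qed.

Lemma one_tmap_inj X Y (f g : hom X Y) : id1 one ⊠ f = id1 one ⊠ g -> f = g.
Proof.
move=> e; apply: (iso_epi (a := lun X)).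
by rewrite -!lun_nat e.
Qed.

Lemma tmap_one_inj X Y (f g : hom X Y) : f ⊠ id1 one = g ⊠ id1 one -> f = g.
Proof.
move=> e; apply: (iso_epi (a := run X)).
by rewrite -!run_nat e.
Qed.

Definition tmap_iso X Y X' Y' (a : iso X Y) (b : iso X' Y') :
  iso (X ⊗ X') (Y ⊗ Y').
Proof.
exists (fwd a ⊠ fwd b) (bwd a ⊠ bwd b); rewrite tmap_comp.
- by rewrite !bwdK tmap_id.
- by rewrite !fwdK tmap_id.
Defined.

Definition id_iso (X : C) : iso X X :=
  Iso (comp_idl (id1 X)) (comp_idl (id1 X)).

Lemma lun_asc X Y : fwd (lun (X ⊗ Y)) ∘ fwd (asc one X Y) = fwd (lun X) ⊠ id1 Y.
Proof.
apply: one_tmap_inj.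
apply: (iso_epi (a := asc one (one ⊗ X) Y)).
apply: (iso_epi (a := tmap_iso (asc one one X) (id_iso Y))) => /=.
rewrite -(comp_idl (id1 one)) -tmap_comp comp_idl -!compA.
have -> : id1 one ⊠ fwd (asc one X Y) ∘ (fwd (asc one (one ⊗ X) Y)
   ∘ fwd (asc one one X) ⊠ id1 Y) =
   fwd (asc one one (X ⊗ Y)) ∘ fwd (asc (one ⊗ one) X Y).
  by rewrite pentagon -!compA.
rewrite (comp_reA1 _ (triangle _ _)).
rewrite -[id1 (X ⊗ Y)]tmap_id -asc_nat.
rewrite (comp_reA _ (esym (asc_nat _ _ _))).
by rewrite tmap_comp triangle comp_idl.
Qed.

Lemma run_asc X Y : id1 X ⊠ fwd (run Y) ∘ fwd (asc X Y one) = fwd (run (X ⊗ Y)).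
Proof.
apply: tmap_one_inj.
apply: (iso_mono (a := asc X Y one)).
rewrite -[fwd (run (X ⊗ Y)) ⊠ _]triangle.
rewrite compA -[id1 (X ⊗ Y)]tmap_id asc_nat -compA pentagon.
rewrite -[in LHS](comp_idl (id1 one)) -tmap_comp (comp_reA _ (asc_nat _ _ _)).
by rewrite -triangle -compA (comp_reA1 _ (tmap_comp _ _ _ _)) comp_idl.
Qed.

Lemma lun_run_one : fwd (lun one) = fwd (run one) :> hom (one ⊗ one) (@one C).
Proof.
apply: tmap_one_inj.
rewrite -triangle -lun_asc; congr (_ ∘ _).
by apply: (iso_mono (a := lun one)); rewrite lun_nat.
Qed.

Lemma lun_asc' X Y : fwd (asc one X Y) ∘ (bwd (lun X) ⊠ id1 Y) = bwd (lun (X ⊗ Y)).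
Proof.
apply: (iso_mono (a := lun (X ⊗ Y))).
by rewrite compA lun_asc tmap_comp !fwdK comp_idl tmap_id.
Qed.

Lemma run_asc' X Y : fwd (run (X ⊗ Y)) ∘ bwd (asc X Y one) = id1 X ⊠ fwd (run Y).
Proof. by rewrite -run_asc -compA fwdK comp_idr. Qed.

Lemma triangle' X Y : (fwd (run X) ⊠ id1 Y) ∘ bwd (asc X one Y) ∘
  (id1 X ⊠ bwd (lun Y)) = id1 (X ⊗ Y).
Proof.
rewrite -triangle -!compA (comp_reA1 _ (fwdK _)) comp_idl.
by rewrite tmap_comp fwdK comp_idl tmap_id.
Qed.

Lemma pentagon' W X Y Z :
  fwd (asc (W ⊗ X) Y Z) ∘ (bwd (asc W X Y) ⊠ id1 Z) ∘ bwd (asc W (X ⊗ Y) Z)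
  = bwd (asc W X (Y ⊗ Z)) ∘ (id1 W ⊠ fwd (asc X Y Z)).
Proof.
apply: (iso_mono (a := asc W X (Y ⊗ Z))).
rewrite !compA fwdK comp_idl pentagon -!compA.
rewrite (comp_reA1 _ (tmap_comp _ _ _ _)) fwdK comp_idl tmap_id comp_idl.
by rewrite fwdK comp_idr.
Qed.

Lemma cons_fwdK A (F : A -> C) a s : cons_bwd F a s ∘ cons_fwd F a s = id1 _.
Proof. by case: s => [|b s] /=; rewrite ?comp_idl // fwdK. Qed.

Lemma cons_bwdK A (F : A -> C) a s : cons_fwd F a s ∘ cons_bwd F a s = id1 _.
Proof. by case: s => [|b s] /=; rewrite ?comp_idl // bwdK. Qed.

Definition cons_iso A (F : A -> C) a s : iso (tens F (a :: s)) (F a ⊗ tens F s) :=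
  Iso (cons_fwdK F a s) (cons_bwdK F a s).

Section Maps.
Variables (A B : Type) (F : A -> C) (G : B -> C).

Lemma cons_fwd_nat a s b t (fs : homs F G (a :: s) (b :: t)) :
  cons_fwd G b t ∘ tens_map fs = fs.1 ⊠ tens_map (fs.2 : homs F G s t) ∘ cons_fwd F a s.
Proof.
case: s t fs => [|a' s] [|b' t] [f fs] //=.
- by rewrite run_nat'.
- by rewrite comp_idl comp_idr.
Qed.

Lemma cons_bwd_nat a s b t (fs : homs F G (a :: s) (b :: t)) :
  cons_bwd G b t ∘ (fs.1 ⊠ tens_map (fs.2 : homs F G s t)) = tens_map fs ∘ cons_bwd F a s.
Proof.
apply: (iso_sq (a := cons_iso F a s) (b := cons_iso G b t)).
exact: cons_fwd_nat.
Qed.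

Lemma tens_map_cons a s b t (fs : homs F G (a :: s) (b :: t)) :
  tens_map fs = cons_bwd G b t ∘ (fs.1 ⊠ tens_map (fs.2 : homs F G s t)) ∘ cons_fwd F a s.
Proof. by rewrite cons_bwd_nat -compA cons_fwdK comp_idr. Qed.

Lemma cat_can_nat s s' t t' (fs : homs F G s t) (fs' : homs F G s' t') :
  cat_can G t t' ∘ tens_map (pw_cat fs fs' : homs F G (s ++ s') (t ++ t'))
  = tens_map fs ⊠ tens_map fs' ∘ cat_can F s s'.
Proof.
elim: s t fs => [|a s IH] [|b t] // => [[]|[f fs]].
  by rewrite [cat_can _ _ _]/= [pw_cat _ _]/= lun_nat'.
rewrite [cat_can G _ _]/= -!compA.
rewrite (cons_fwd_nat (a := a) (b := b) ((f, pw_cat fs fs') : homs F G (a :: s ++ s') (b :: t ++ t'))) /=.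
rewrite (comp_reA1 _ (tmap_comp _ _ _ _)) comp_idl IH.
rewrite -[X in X ⊠ (_ ∘ _)]comp_idr -tmap_comp -!compA.
rewrite (comp_reA _ (asc_nat' _ _ _)) (comp_reA1 _ (tmap_comp _ _ _ _)).
rewrite comp_idl (cons_bwd_nat ((f, fs) : homs F G (a :: s) (b :: t))) -(comp_idr (tens_map fs')).
by rewrite -tmap_comp comp_idr !compA.
Qed.

End Maps.

Lemma flatten_can_cons A (F : A -> C) s ss :
  flatten_can F (s :: ss) = cons_bwd (tens F) s ss
    ∘ (id1 (tens F s) ⊠ flatten_can F ss) ∘ cat_can F s (flatten ss).
Proof. by []. Qed.

Lemma flatten_can_nat A B (F : A -> C) (G : B -> C) ss tt
    (fss : pointwise (pointwise (fun a b => hom (F a) (G b))) ss tt) :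
  flatten_can G tt ∘ tens_map (pw_flatten fss : homs F G _ _)
  = tens_map (pw_map (@tens_map C A B F G) fss : homs (tens F) (tens G) ss tt)
    ∘ flatten_can F ss.
Proof.
elim: ss tt fss => [|s ss IH] [|t tt] // => [[fs fss]] /=.
rewrite -!compA cat_can_nat (comp_reA1 _ (tmap_comp _ _ _ _)) comp_idl IH.
rewrite -[X in X ⊠ (_ ∘ _)]comp_idr -tmap_comp -!compA.
by rewrite (comp_reA _ (cons_bwd_nat ((tens_map fs, pw_map (@tens_map C A B F G) fss)
   : homs (tens F) (tens G) (s :: ss) (t :: tt)))).
Qed.

Lemma tens_map_comp A B D (F : A -> C) (G : B -> C) (H : D -> C) s t u
    (gs : homs G H t u) (fs : homs F G s t) :
  tens_map gs ∘ tens_map fs =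
  tens_map (pw_comp (fun a b d => @comp C (F a) (G b) (H d)) gs fs : homs F H s u).
Proof.
elim: s t u gs fs => [|a s IH] [|b t] [|d u] // => [[] []|[g gs] [f fs]].
  exact: comp_idl.
rewrite !tens_map_cons -!compA (comp_reA1 _ (cons_bwdK _ _ _)) comp_idl.
by rewrite (comp_reA1 _ (tmap_comp _ _ _ _)) IH.
Qed.

Lemma tens_map_id A (F : A -> C) s (f : forall a, hom (F a) (F a)) :
  (forall a, f a = id1 (F a)) -> tens_map (pw_diag f s : homs F F s s) = id1 (tens F s).
Proof.
move=> fE; elim: s => [|a s IH] //.
by rewrite tens_map_cons /= IH fE tmap_id comp_idr cons_fwdK.
Qed.

Definition tcast A (F : A -> C) (s t : seq A) (e : s = t) : hom (tens F s) (tens F t) :=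
  match e in _ = t return hom (tens F s) (tens F t) with erefl => id1 _ end.

Lemma tcast_id A (F : A -> C) s (e : s = s) : tcast F e = id1 _.
Proof. by rewrite (Prop_irrelevance e erefl). Qed.

Lemma tcast_comp A (F : A -> C) s t u (e : s = t) (e' : t = u) (e'' : s = u) :
  tcast F e' ∘ tcast F e = tcast F e''.
Proof. by subst u t; rewrite !tcast_id comp_idl. Qed.

Lemma cons_fwd_cast A (F : A -> C) a s t (e : s = t) (e' : a :: s = a :: t) :
  cons_fwd F a t ∘ tcast F e' = id1 _ ⊠ tcast F e ∘ cons_fwd F a s.
Proof. by subst t; rewrite !tcast_id tmap_id comp_idl comp_idr. Qed.

Lemma cons_bwd_cast A (F : A -> C) a s t (e : s = t) (e' : a :: s = a :: t) :
  cons_bwd F a t ∘ (id1 _ ⊠ tcast F e) = tcast F e' ∘ cons_bwd F a s.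
Proof. by subst t; rewrite !tcast_id tmap_id comp_idl comp_idr. Qed.

Lemma cat_can_cast A (F : A -> C) s s' t (e : s = s') (e' : s ++ t = s' ++ t) :
  cat_can F s' t ∘ tcast F e' = tcast F e ⊠ id1 _ ∘ cat_can F s t.
Proof. by subst s'; rewrite !tcast_id tmap_id comp_idl comp_idr. Qed.

Lemma cat_can_castr A (F : A -> C) s t t' (e : t = t') (e' : s ++ t = s ++ t') :
  cat_can F s t' ∘ tcast F e' = id1 _ ⊠ tcast F e ∘ cat_can F s t.
Proof. by subst t'; rewrite !tcast_id tmap_id comp_idl comp_idr. Qed.

Lemma cat_canA A (F : A -> C) s t u (e : (s ++ t) ++ u = s ++ (t ++ u)) :
  fwd (asc _ _ _) ∘ (cat_can F s t ⊠ id1 _) ∘ cat_can F (s ++ t) u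
  = (id1 _ ⊠ cat_can F t u) ∘ cat_can F s (t ++ u) ∘ tcast F e.
Proof.
elim: s e => [|a s IH] e.
  by rewrite tcast_id comp_idr /= lun_asc' -lun_nat'.
have e' : (s ++ t) ++ u = s ++ (t ++ u) by rewrite catA.
move: {IH} (IH e') => IH.
rewrite [in LHS]/= [in RHS]/= -!compA (cons_fwd_cast F e' e).
rewrite !tmapl_comp -!compA.
rewrite [X in _ ∘ (_ ∘ (_ ∘ (_ ∘ X)))](comp_reA1 _ (esym (tmapl_comp _ _ _))).
rewrite cons_bwdK tmap_id comp_idl.
rewrite [X in _ ∘ (_ ∘ (_ ∘ X))](comp_reA _ (esym (asc_nat' _ _ _))).
rewrite (comp_reA _ (asc_nat _ _ _)) tmap_id.
rewrite [X in _ ∘ X]compA [X in _ ∘ X]compA pentagon' -!compA.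
rewrite [RHS](comp_reA _ (esym (tmap_swap _ _))); congr (_ ∘ _).
rewrite -[id1 (F a ⊗ _)]tmap_id (comp_reA _ (esym (asc_nat' _ _ _))); congr (_ ∘ _).
rewrite 3!(comp_reA1 _ (esym (tmapr_comp _ _ _))).
rewrite !compA -!tmapr_comp -!compA.
by rewrite compA IH !compA.
Qed.

Lemma cat_canA' A (F : A -> C) s t u (e : (s ++ t) ++ u = s ++ (t ++ u)) :
  (cat_can F s t ⊠ id1 _) ∘ cat_can F (s ++ t) u
  = bwd (asc _ _ _) ∘ (id1 _ ⊠ cat_can F t u) ∘ cat_can F s (t ++ u) ∘ tcast F e.
Proof.
apply: (iso_mono (a := asc _ _ _)).
by rewrite !compA fwdK comp_idl cat_canA.
Qed.

Lemma cat_can_nil A (F : A -> C) s (e : s = s ++ [::]) :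
  fwd (run _) ∘ cat_can F s [::] ∘ tcast F e = id1 _.
Proof.
elim: s e => [|a s IH] e.
  by rewrite tcast_id comp_idr /= -lun_run_one fwdK.
have e' : s = s ++ [::] by rewrite cats0.
move: {IH} (IH e') => IH.
rewrite [cat_can _ _ _]/= -!compA (cons_fwd_cast F e' e).
rewrite (comp_reA _ (run_nat _)) (comp_reA1 _ (run_asc' _ _)).
rewrite !(comp_reA1 _ (esym (tmapr_comp _ _ _))).
by rewrite IH tmap_id comp_idl cons_fwdK.
Qed.

Lemma cat_can_single A (F : A -> C) a t : cat_can F [:: a] t = cons_fwd F a t.
Proof. by rewrite /= triangle' comp_idl. Qed.

Lemma flatten_can_cat A (F : A -> C) (ss tt : seq (seq A))
    (e : flatten (ss ++ tt) = flatten ss ++ flatten tt) :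
  cat_can (tens F) ss tt ∘ flatten_can F (ss ++ tt)
  = (flatten_can F ss ⊠ flatten_can F tt) ∘ cat_can F (flatten ss) (flatten tt)
    ∘ tcast F e.
Proof.
elim: ss e => [|s ss IH] e.
  by rewrite tcast_id comp_idr /= lun_nat'.
have e1 : flatten (ss ++ tt) = flatten ss ++ flatten tt by rewrite flatten_cat.
have e2 : (s ++ flatten ss) ++ flatten tt = s ++ (flatten ss ++ flatten tt).
  by rewrite catA.
have e3 : s ++ flatten (ss ++ tt) = s ++ (flatten ss ++ flatten tt).
  by rewrite flatten_cat.
move: {IH} (IH e1) => IH.
rewrite [flatten_can F (s :: ss)]/= [LHS]/= -!compA.
rewrite (comp_reA1 _ (cons_bwdK _ _ _)) comp_idl.
rewrite (comp_reA1 _ (esym (tmapr_comp _ _ _))) IH.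
rewrite !tmapr_comp -!compA -(cat_can_castr F e1 e3).
rewrite (comp_reA _ (asc_nat' _ _ _)) (comp_reA1 _ (tmap_comp _ _ _ _)) comp_idl.
rewrite -(tcast_comp F e e2 e3) [in LHS]compA.
rewrite (_ : (cons_bwd (tens F) s ss ∘ _) ⊠ flatten_can F tt =
  ((cons_bwd (tens F) s ss ∘ (id1 (tens F s) ⊠ flatten_can F ss)) ⊠ flatten_can F tt)
  ∘ (cat_can F s (flatten ss) ⊠ id1 _)); last first.
  by rewrite tmap_comp comp_idr !compA.
rewrite -!compA; congr (_ ∘ _).
rewrite [in RHS]compA (cat_canA' F e2) -!compA.
by [].
Qed.

Lemma flatten_can_single A (F : A -> C) s (e : s = flatten [:: s]) :
  flatten_can F [:: s] ∘ tcast F e = id1 (tens F s).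
Proof. by rewrite /= tmap_id comp_idr cat_can_nil. Qed.

Lemma flatten_can_singles A (F : A -> C) s
    (e : s = flatten [seq [:: a] | a <- s]) :
  tens_map (pw_cograph (fun a => id1 (F a)) s
            : homs (tens F) F [seq [:: a] | a <- s] s)
  ∘ flatten_can F [seq [:: a] | a <- s] ∘ tcast F e = id1 (tens F s).
Proof.
elim: s e => [|a s IH] e; first by rewrite tcast_id !comp_idl.
have e' := flatten_single s.
move: {IH} (IH e') => IH.
have -> : flatten_can F [seq [:: a] | a <- a :: s] =
    cons_bwd (tens F) [:: a] [seq [:: a] | a <- s]
    ∘ (id1 (F a) ⊠ flatten_can F [seq [:: a] | a <- s])
    ∘ cons_fwd F a (flatten [seq [:: a] | a <- s]).
  by rewrite -cat_can_single.
rewrite tens_map_cons -!compA (cons_fwd_cast F e' e).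
rewrite (comp_reA1 _ (cons_bwdK _ _ _)) comp_idl.
rewrite (comp_reA1 _ (esym (tmapr_comp _ _ _))).
rewrite (comp_reA1 _ (tmap_comp _ _ _ _)) /= comp_idl.
by rewrite compA IH tmap_id comp_idr cons_fwdK.
Qed.

Lemma flatten_canA A (F : A -> C) sss
    (e : flatten (flatten sss) = flatten (map flatten sss)) :
  flatten_can (tens F) sss ∘ flatten_can F (flatten sss)
  = tens_map (pw_cograph (fun ss => flatten_can F ss) sss
              : homs (tens F) (tens (tens F)) (map flatten sss) sss)
    ∘ flatten_can F (map flatten sss) ∘ tcast F e.
Proof.
elim: sss e => [|ss sss IH] e; first by rewrite tcast_id !comp_idr.
have e1 := flatten_flatten sss.
have e2 := flatten_cat ss (flatten sss).
have e3 : flatten ss ++ flatten (flatten sss) =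
          flatten ss ++ flatten (map flatten sss) by rewrite e1.
move: {IH} (IH e1) => IH.
rewrite [LHS]/= -!compA (flatten_can_cat F e2).
rewrite [in RHS]/= [X in _ = X ∘ _]tens_map_cons -!compA.
rewrite (comp_reA1 _ (cons_bwdK _ _ _)) comp_idl.
rewrite -(tcast_comp F e2 e3 e) [in RHS](comp_reA _ (cat_can_castr F e1 e3)).
rewrite !(comp_reA1 _ (tmap_comp _ _ _ _)) !comp_idl !comp_idr.
by rewrite IH !compA.
Qed.

End Coherence.

Section Phis.
Variables (C : monoidal_category) (T : monoidal_monad C).

Lemma phi_asc' (X Y Z : C) :
  fmap T (bwd (asc X Y Z)) ∘ (phi T X (Y ⊗ Z) ∘ (id1 (T X) ⊠ phi T Y Z))
  = phi T (X ⊗ Y) Z ∘ (phi T X Y ⊠ id1 (T Z)) ∘ bwd (asc (T X) (T Y) (T Z)).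
Proof.
apply: (iso_epi (a := asc (T X) (T Y) (T Z))).
rewrite -[RHS]compA bwdK comp_idr -compA -phi_asc !compA.
by rewrite -fmap_comp bwdK fmap_id comp_idl.
Qed.

Lemma phis_cons A (F : A -> C) a s :
  fmap T (cons_fwd F a s) ∘ phis T F (a :: s)
  = phi T (F a) (tens F s) ∘ (id1 (T (F a)) ⊠ phis T F s)
    ∘ cons_fwd (fun a => T (F a)) a s.
Proof.
case: s => [|b s] /=; last by rewrite fmap_id comp_idl comp_idr.
apply: (iso_epi (a := run (T (F a)))).
rewrite comp_idr -!compA bwdK comp_idr -phi_run -!compA.
by rewrite (comp_reA1 _ (esym (fmap_comp _ _ _))) bwdK fmap_id comp_idl.
Qed.

Lemma phis_consE A (F : A -> C) a s :
  phis T F (a :: s)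
  = fmap T (cons_bwd F a s) ∘ phi T (F a) (tens F s)
    ∘ (id1 (T (F a)) ⊠ phis T F s) ∘ cons_fwd (fun a => T (F a)) a s.
Proof.
rewrite -!compA [X in _ = _ ∘ X]compA -phis_cons.
by rewrite compA -fmap_comp cons_fwdK fmap_id comp_idl.
Qed.

Lemma phis_nat A B (F : A -> C) (G : B -> C) s t (fs : homs F G s t) :
  fmap T (tens_map fs) ∘ phis T F s
  = phis T G t ∘ tens_map (pw_map (fun a b (f : hom (F a) (G b)) => fmap T f) fs
      : homs (fun a => T (F a)) (fun b => T (G b)) s t).
Proof.
elim: s t fs => [|a s IH] [|b t] // => [[]|[f fs]].
  by rewrite /= fmap_id comp_idl comp_idr.
rewrite !phis_consE tens_map_cons [in RHS]tens_map_cons !fmap_comp -!compA.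
rewrite (comp_reA1 _ (esym (fmap_comp _ (cons_fwd _ _ _) (cons_bwd _ _ _)))) cons_bwdK fmap_id comp_idl.
rewrite (comp_reA1 _ (cons_bwdK _ _ _)) comp_idl.
rewrite (comp_reA _ (esym (phi_nat _ _ _))) !(comp_reA1 _ (tmap_comp _ _ _ _)).
by rewrite !comp_idl comp_idr IH.
Qed.

Lemma phis_cat A (F : A -> C) s t :
  fmap T (cat_can F s t) ∘ phis T F (s ++ t)
  = phi T _ _ ∘ (phis T F s ⊠ phis T F t) ∘ cat_can (fun a => T (F a)) s t.
Proof.
elim: s => [|a s IH].
  rewrite /=; apply: (iso_epi (a := lun _)); rewrite -!compA.
  rewrite bwdK comp_idr -lun_nat -phi_lun -!compA.
  rewrite (comp_reA1 _ (esym (fmap_comp _ _ _))) bwdK fmap_id comp_idl.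
  by rewrite tmap_comp comp_idl comp_idr.
rewrite [cat_can F _ _]/= [cat_can _ (a :: s) _]/= !fmap_comp -!compA.
rewrite [phis T F (_ ++ _)]phis_consE -!compA.
rewrite (comp_reA1 _ (esym (fmap_comp _ (cons_fwd _ _ _) (cons_bwd _ _ _)))) cons_bwdK fmap_id comp_idl.
rewrite (comp_reA _ (esym (phi_nat _ _ _))) (comp_reA1 _ (tmap_comp _ _ _ _)).
rewrite fmap_id comp_idl IH.
have E : phis T F (a :: s) ∘ cons_bwd (fun a => T (F a)) a s =
    fmap T (cons_bwd F a s) ∘ (phi T (F a) (tens F s) ∘ (id1 _ ⊠ phis T F s)).
  by rewrite phis_consE -!compA (cons_bwdK (fun a => T (F a))) comp_idr.
rewrite [in RHS](comp_reA1 _ (tmap_comp _ _ _ _)) E comp_idr.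
have -> : (fmap T (cons_bwd F a s) ∘ (phi T (F a) (tens F s)
      ∘ (id1 (T (F a)) ⊠ phis T F s))) ⊠ phis T F t
    = (fmap T (cons_bwd F a s) ⊠ fmap T (id1 _)) ∘ (phi T (F a) (tens F s) ⊠ id1 _)
      ∘ ((id1 (T (F a)) ⊠ phis T F s) ⊠ phis T F t).
  by rewrite !tmap_comp fmap_id !comp_idl -compA.
rewrite -!compA -(comp_reA _ (asc_nat' _ _ _)).
rewrite [in RHS](comp_reA _ (phi_nat _ _ _)) !tmapr_comp -!compA.
congr (_ ∘ _); rewrite !compA; congr (_ ∘ _ ∘ _ ∘ _).
by rewrite -!compA phi_asc' !compA.
Qed.

Lemma phis_flatten A (F : A -> C) ss :
  fmap T (flatten_can F ss) ∘ phis T F (flatten ss)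
  = phis T (tens F) ss
    ∘ tens_map (pw_diag (phis T F) ss
        : homs (tens (fun a => T (F a))) (fun s => T (tens F s)) ss ss)
    ∘ flatten_can (fun a => T (F a)) ss.
Proof.
elim: ss => [|s ss IH]; first by rewrite /= fmap_id comp_idl !comp_idr.
rewrite !flatten_can_cons phis_consE tens_map_cons !fmap_comp -!compA phis_cat.
rewrite (comp_reA1 _ (cons_bwdK (fun s => T (tens F s)) _ _)) comp_idl.
rewrite (comp_reA1 _ (cons_bwdK _ _ _)) comp_idl.
rewrite -!compA (comp_reA _ (esym (phi_nat _ _ _))) fmap_id !(comp_reA1 _ (tmap_comp _ _ _ _)).
rewrite /=.
by rewrite !comp_idl !comp_idr IH !compA.
Qed.
End Phis.

Definition pw_castr A B (R : A -> B -> Type) (s : seq A) (t t' : seq B)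
    (e : t = t') : pointwise R s t -> pointwise R s t' :=
  match e in _ = t' return pointwise R s t -> pointwise R s t' with erefl => id end.

Lemma pw_castr_id A B (R : A -> B -> Type) (s : seq A) (t : seq B) (e : t = t)
  (r : pointwise R s t) : pw_castr e r = r.
Proof. by rewrite (Prop_irrelevance e erefl). Qed.

Lemma pw_castr_cons A B (R : A -> B -> Type) a b (s : seq A) (t t' : seq B)
    (e' : t = t') (e : b :: t = b :: t') (r : R a b) (rs : pointwise R s t) :
  pw_castr e ((r, rs) : pointwise R (a :: s) (b :: t)) = (r, pw_castr e' rs).
Proof. by subst t'; rewrite !pw_castr_id. Qed.

Lemma pw_castr_graph_cat A B (R : A -> B -> Type) (h : A -> B)
    (f : forall a, R a (h a)) s1 s2 t (e2 : map h s2 = t)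
    (e : map h (s1 ++ s2) = map h s1 ++ t) :
  pw_castr e (pw_graph f (s1 ++ s2))
  = pw_cat (pw_graph f s1) (pw_castr e2 (pw_graph f s2)).
Proof.
elim: s1 e => [|a s1 IH] e; first by rewrite (Prop_irrelevance e e2).
have e' : map h (s1 ++ s2) = map h s1 ++ t by rewrite map_cat e2.
by rewrite [RHS]/= -(IH e') -pw_castr_cons.
Qed.

Lemma pw_castr_graph_flatten A B (R : A -> B -> Type) (h : A -> B)
    (f : forall a, R a (h a)) ss (e : map h (flatten ss) = flatten (map (map h) ss)) :
  pw_castr e (pw_graph f (flatten ss))
  = pw_flatten (pw_graph (pw_graph f) ss).
Proof.
elim: ss e => [|s ss IH] e; first by rewrite pw_castr_id.
by rewrite (pw_castr_graph_cat f (map_flatten h ss)) IH.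
Qed.

Lemma tens_map_castr (C : monoidal_category) A B (F : A -> C) (G : B -> C) s t t'
    (e : t = t') (fs : homs F G s t) :
  tens_map (pw_castr e fs : homs F G s t') = tcast G e ∘ tens_map fs.
Proof. by subst t'; rewrite pw_castr_id comp_idl. Qed.

Section PhiStructure.
Variables (C : monoidal_category) (T : monoidal_monad C) (u : universal_choice T).
Local Notation alg := (alg_cat T).
Local Notation car := (@car C T).

Lemma multilinear_comp (Vs : seq alg) (V W : alg) (g : hom V W)
    (f : hom (tens car Vs) (car V)) :
  multilinear f -> multilinear (map_of g ∘ f).
Proof.
move=> hf; rewrite /multilinear fmap_comp !compA -map_ofP -!compA; congr (_ ∘ _).
by rewrite compA.
Qed.

Definition lift (Vs : seq alg) (W : alg) (f : hom (tens car Vs) (car W))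
    (hf : multilinear f) : hom (uobj u Vs) W :=
  projT1 (cid ((umapP u Vs).2 W f hf)).

Lemma liftE Vs W f hf : map_of (@lift Vs W f hf) ∘ umap u Vs = f.
Proof. by rewrite /lift; case: cid => g [/= ->]. Qed.

Lemma umap_epi Vs (W : alg) (g h : hom (uobj u Vs) W) :
  map_of g ∘ umap u Vs = map_of h ∘ umap u Vs -> g = h.
Proof.
move=> e; have [hu univ] := umapP u Vs.
have [k [_ kU]] := univ W _ (multilinear_comp g hu).
by rewrite -(kU g erefl); apply: kU.
Qed.

Definition alg_homs (Vs Ws : seq alg) (fs : @hom (seq_cat alg) Vs Ws) :
    homs car car Vs Ws :=
  pw_map (fun V W (f : @hom alg V W) => map_of f) fs.

Lemma otimes_subproof Vs Ws (fs : @hom (seq_cat alg) Vs Ws) :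
  multilinear (umap u Ws ∘ tens_map (alg_homs fs)).
Proof.
have [hu _] := umapP u Ws.
rewrite /multilinear fmap_comp -!compA phis_nat !compA hu -!compA; congr (_ ∘ _).
rewrite !tens_map_comp; congr tens_map.
elim: Vs Ws fs {hu} => [|V Vs IH] [|W Ws] // => [[f fs]] /=.
congr (_, _); last exact: IH.
by rewrite map_ofP.
Qed.

Definition otimes_map Vs Ws (fs : @hom (seq_cat alg) Vs Ws) :
  hom (uobj u Vs) (uobj u Ws) := lift (otimes_subproof fs).

Lemma otimes_mapE Vs Ws (fs : @hom (seq_cat alg) Vs Ws) :
  map_of (otimes_map fs) ∘ umap u Vs = umap u Ws ∘ tens_map (alg_homs fs).
Proof. exact: liftE. Qed.

Lemma otimes_map_id Vs : otimes_map (id1 (Vs : seq_cat alg)) = id1 (uobj u Vs).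
Proof.
apply: umap_epi; rewrite otimes_mapE comp_idl.
rewrite -[RHS]comp_idr; congr (_ ∘ _).
rewrite -(tens_map_id Vs (f := fun V => id1 (car V))) //; congr tens_map.
by elim: Vs => //= V Vs IH; congr (_, _).
Qed.

Lemma otimes_map_comp (Vs Ws Zs : seq_cat alg) (gs : hom Ws Zs) (fs : hom Vs Ws) :
  otimes_map (gs ∘ fs) = otimes_map gs ∘ otimes_map fs.
Proof.
apply: umap_epi; rewrite otimes_mapE /= -compA otimes_mapE compA otimes_mapE.
rewrite -compA; congr (_ ∘ _); rewrite tens_map_comp; congr tens_map.
elim: Vs Ws Zs gs fs => [|V Vs IH] [|W Ws] [|Z Zs] //= => [[g gs] [f fs]] /=.
by congr (_, _); exact: IH.
Qed.

Definition phi_otimes : functor (seq_cat alg) alg :=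
  @Functor (seq_cat alg) alg (uobj u) otimes_map otimes_map_id otimes_map_comp.

Lemma epsilon_subproof (V : alg) :
  @multilinear C T [:: V] V (id1 (car V)).
Proof. by rewrite /multilinear /= fmap_id !comp_idr comp_idl. Qed.

Definition phi_epsilon (V : alg) : hom (uobj u [:: V]) V :=
  lift (epsilon_subproof V).

Lemma phi_epsilonE V : map_of (phi_epsilon V) ∘ umap u [:: V] = id1 (car V).
Proof. exact: liftE. Qed.

Definition umaps (Vss : seq (seq alg)) :
    homs (tens car) car Vss (map (uobj u) Vss) :=
  pw_graph (umap u) Vss.

Lemma alpha_subproof (Vss : seq (seq alg)) :
  multilinear (umap u (map (uobj u) Vss) ∘ tens_map (umaps Vss)
    ∘ flatten_can car Vss).
Proof.
have [hu _] := umapP u (map (uobj u) Vss).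
rewrite /multilinear !fmap_comp -!compA phis_flatten.
rewrite [X in _ ∘ (_ ∘ X)]compA [X in _ ∘ (_ ∘ (X ∘ _))]compA phis_nat.
rewrite !compA hu -!compA; congr (_ ∘ _).
have -> : strs (flatten Vss) = pw_flatten (pw_diag (@strs C T) Vss).
  elim: Vss {hu} => //= Vs Vss <-; rewrite /strs.
  by elim: Vs => //= V Vs ->.
rewrite flatten_can_nat !compA; congr (_ ∘ _).
rewrite !tens_map_comp; congr tens_map.
elim: Vss {hu} => //= Vs Vss IH; congr (_, _); last exact: IH.
by rewrite -compA; have [<- _] := umapP u Vs; rewrite compA.
Qed.

Definition phi_alpha (Vss : seq (seq alg)) :
    hom (uobj u (flatten Vss)) (uobj u (map (uobj u) Vss)) :=
  lift (alpha_subproof Vss).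

Lemma phi_alphaE Vss : map_of (phi_alpha Vss) ∘ umap u (flatten Vss)
  = umap u (map (uobj u) Vss) ∘ tens_map (umaps Vss) ∘ flatten_can car Vss.
Proof. exact: liftE. Qed.

Lemma map_of_comp (V W Z : alg) (g : hom W Z) (f : hom V W) :
  map_of (g ∘ f) = map_of g ∘ map_of f.
Proof. by []. Qed.

Lemma phi_fmapE (Vs Ws : seq alg) (fs : @hom (seq_cat alg) Vs Ws) :
  map_of (fmap phi_otimes fs) = map_of (otimes_map fs).
Proof. by []. Qed.

Local Definition mapE := (map_of_comp, phi_fmapE).

Lemma phi_epsilon_nat (V W : alg) (f : hom V W) :
  phi_epsilon W ∘ fmap phi_otimes ((f, tt) : @hom (seq_cat alg) [:: V] [:: W])
  = f ∘ phi_epsilon V.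
Proof.
apply: umap_epi; rewrite !mapE -!compA otimes_mapE phi_epsilonE compA phi_epsilonE.
by rewrite comp_idl comp_idr.
Qed.

Lemma phi_alpha_nat (Vss Wss : seq (seq alg))
    (fss : @hom (seq_cat (seq_cat alg)) Vss Wss) :
  phi_alpha Wss ∘ fmap phi_otimes
    (pw_flatten fss : @hom (seq_cat alg) (flatten Vss) (flatten Wss))
  = fmap phi_otimes (pw_image (@fmap _ _ phi_otimes) fss
      : @hom (seq_cat alg) (map phi_otimes Vss) (map phi_otimes Wss))
    ∘ phi_alpha Vss.
Proof.
apply: umap_epi; rewrite !mapE -!compA otimes_mapE phi_alphaE.
rewrite !compA phi_alphaE otimes_mapE -!compA; congr (_ ∘ _).
have -> : alg_homs (pw_flatten fss) =
    pw_flatten (pw_map (fun Vs Ws fs => @alg_homs Vs Ws fs) fss).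
  elim: Vss Wss fss => [|Vs Vss IH] [|Ws Wss] //= => [[fs fss]] /=.
  rewrite -IH; elim: Vs Ws fs => [|V Vs IHs] [|W Ws] //= => [[f fs]] /=.
  by rewrite -IHs.
rewrite flatten_can_nat !compA; congr (_ ∘ _).
rewrite !tens_map_comp; congr tens_map.
elim: Vss Wss fss => [|Vs Vss IH] [|Ws Wss] //= => [[fs fss]] /=.
by congr (_, _); [rewrite otimes_mapE|exact: IH].
Qed.

Lemma otimes_map_eq (Vs Ws : seq alg) (e : Vs = Ws) :
  map_of (otimes_map (eq_hom (e : Vs = Ws :> seq_cat alg))) ∘ umap u Vs
  = umap u Ws ∘ tcast car e.
Proof. by subst Ws; rewrite [eq_hom _]/= otimes_map_id comp_idl comp_idr. Qed.

Lemma phi_coassoc (Vsss : seq (seq (seq alg))) :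
  fmap phi_otimes (alpha_seq phi_alpha Vsss)
  ∘ phi_alpha (map flatten Vsss)
  ∘ fmap phi_otimes (eq_hom (flatten_flatten Vsss : _ = _ :> seq_cat alg))
  = phi_alpha (map (map phi_otimes) Vsss)
  ∘ fmap phi_otimes (eq_hom (map_flatten phi_otimes Vsss : _ = _ :> seq_cat alg))
  ∘ phi_alpha (flatten Vsss).
Proof.
apply: umap_epi; rewrite !mapE -!compA otimes_map_eq phi_alphaE.
rewrite [X in _ ∘ X]compA phi_alphaE !compA otimes_mapE.
rewrite -[X in _ = X ∘ _ ∘ _]compA otimes_map_eq !compA phi_alphaE -!compA.
congr (_ ∘ _).
rewrite [X in _ = _ ∘ (_ ∘ X)]compA -tens_map_castr pw_castr_graph_flatten.
rewrite [X in _ = _ ∘ X]compA flatten_can_nat -!compA.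
rewrite (flatten_canA car (flatten_flatten Vsss)).
rewrite !compA !tens_map_comp; congr (tens_map _ ∘ _ ∘ _).
elim: Vsss => //= Vss Vsss IH; congr (_, _); last exact: IH.
by rewrite phi_alphaE.
Qed.

Lemma phi_counitl (Vs : seq alg) :
  phi_epsilon (phi_otimes Vs) ∘ phi_alpha [:: Vs]
  ∘ fmap phi_otimes (eq_hom (flatten_singleton Vs : _ = _ :> seq_cat alg))
  = id1 (phi_otimes Vs).
Proof.
apply: umap_epi; rewrite !mapE -!compA otimes_map_eq.
rewrite [X in _ ∘ X]compA phi_alphaE !compA phi_epsilonE comp_idl.
rewrite -[RHS]comp_idr.
by rewrite -[X in _ = _ ∘ X](flatten_can_single car (flatten_singleton Vs)) !compA.
Qed.

Lemma phi_counitr (Vs : seq alg) :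
  fmap phi_otimes (epsilon_seq phi_epsilon Vs) ∘ phi_alpha [seq [:: V] | V <- Vs]
  ∘ fmap phi_otimes (eq_hom (flatten_single Vs : _ = _ :> seq_cat alg))
  = id1 (phi_otimes Vs).
Proof.
apply: umap_epi; rewrite !mapE -!compA otimes_map_eq.
rewrite [X in _ ∘ X]compA phi_alphaE !compA otimes_mapE -!compA.
rewrite comp_idl -[RHS]comp_idr; congr (_ ∘ _).
rewrite -(flatten_can_singles car (flatten_single Vs)) !compA.
rewrite tens_map_comp; congr (tens_map _ ∘ _ ∘ _).
elim: Vs => //= V Vs IH; congr (_, _); last exact: IH.
by rewrite phi_epsilonE.
Qed.

(* By [umap_epi], the functor [phi_otimes] and the morphisms [phi_epsilon],
   [phi_alpha] are uniquely determined by the equations [otimes_mapE],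
   [phi_epsilonE] and [phi_alphaE]. *)
Definition phi_structure : colax_monoidal alg :=
  ColaxMonoidal phi_epsilon_nat phi_alpha_nat phi_coassoc phi_counitl phi_counitr.

Lemma phi_structure_normal : is_normal phi_structure.
Proof.
move=> V; have [hu _] := umapP u [:: V].
have gP : umap u [:: V] ∘ str V = str (uobj u [:: V]) ∘ fmap T (umap u [:: V]).
  by move: hu; rewrite /multilinear /= comp_idr.
pose g : @hom alg V (uobj u [:: V]) := AlgHom gP.
exists g; split.
  by apply: umap_epi; rewrite !mapE -compA phi_epsilonE comp_idl comp_idr.
by apply: alg_hom_inj; rewrite /= phi_epsilonE.
Qed.
End PhiStructure.

(* Main.v *)
Require Import Defs.
From mathcomp Require Import all_boot.
Import Defs.

(** Write [û = str ∘ T u : T (⊗ V) -> U] for the algebra morphism extending a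
    universal multilinear map [u].  Since [T] preserves reflexive coequalizers,
    [û] is a coequalizer already in the base category, of the reflexive pair
    [mu ∘ T phi], [T (⊗ v)].  Since the tensor product preserves these too,
    [⊗ û_i] is a coequalizer.  A multilinear map [f] into [W] on a concatenation
    of sequences extends to the multilinear map [w ∘ T f ∘ phi] on the tensor
    product of the free algebras [T (⊗ V^i)]; it coequalizes the tensor product
    of the pairs, hence descends along [⊗ û_i] to a multilinear map on the
    algebras [U_i].  So [u ∘ (⊗ u_i)] is universal, and [alpha], which compares
    two universal maps, is invertible. *)

Set Implicit Arguments.
Unset Strict Implicit.
Unset Printing Implicit Defensive.

Local Open Scope cat_scope.

(** * Isomorphisms and coequalizers in a category *)

Section Category.
Variable C : category.

Lemma is_iso_id (X : C) : is_iso (id1 X).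
Proof. by exists (id1 X); rewrite comp_idl. Qed.

Lemma is_iso_fwd (X Y : C) (a : iso X Y) : is_iso (fwd a).
Proof. by exists (bwd a); rewrite bwdK fwdK. Qed.

Lemma is_iso_bwd (X Y : C) (a : iso X Y) : is_iso (bwd a).
Proof. by exists (fwd a); rewrite bwdK fwdK. Qed.

Lemma is_iso_comp (X Y Z : C) (g : hom Y Z) (f : hom X Y) :
  is_iso g -> is_iso f -> is_iso (g ∘ f).
Proof.
move=> [g' [gK gK']] [f' [fK fK']]; exists (f' ∘ g').
by rewrite -!compA (comp_reA1 _ gK) (comp_reA1 _ fK') !comp_idl.
Qed.

Variables (X Y Q : C) (f g : hom X Y) (q : hom Y Q).

Lemma coequalizer_epi Z (a b : hom Q Z) :
  is_coequalizer f g q -> a ∘ q = b ∘ q -> a = b.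
Proof.
move=> [qE qU] e.
have [|k [_ kU]] := qU Z (a ∘ q); first by rewrite -!compA qE.
by rewrite -(kU a erefl) -(kU b (esym e)).
Qed.

Lemma coequalizer_iso Q' (h : hom Q Q') :
  is_iso h -> is_coequalizer f g q -> is_coequalizer f g (h ∘ q).
Proof.
move=> [h' [hK hK']] [qE qU]; split=> [|Z a aE]; first by rewrite -!compA qE.
have [k [kE kU]] := qU Z a aE; exists (k ∘ h'); split.
  by rewrite -!compA (comp_reA1 _ hK) comp_idl.
by move=> l lE; rewrite (kU (l ∘ h)) -?compA // hK' comp_idr.
Qed.
End Category.

Lemma reflexive_pair_fmap (C D : category) (F : functor C D) (X Y : C)
    (f g : hom X Y) :
  reflexive_pair f g -> reflexive_pair (fmap F f) (fmap F g).
Proof.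
by move=> [s [fs gs]]; exists (fmap F s); rewrite -!fmap_comp fs gs !fmap_id.
Qed.

(** * Coherence isomorphisms and reflexive coequalizers under n-fold tensor products *)

Section Tensor.
Variable C : monoidal_category.

Lemma is_iso_tmap (X Y X' Y' : C) (f : hom X Y) (g : hom X' Y') :
  is_iso f -> is_iso g -> is_iso (f ⊠ g).
Proof.
move=> [f' [fK fK']] [g' [gK gK']]; exists (f' ⊠ g').
by rewrite !tmap_comp fK fK' gK gK' !tmap_id.
Qed.

Lemma is_iso_cat_can A (F : A -> C) s t : is_iso (cat_can F s t).
Proof.
elim: s => [|a s IH]; first exact: is_iso_bwd.
apply: is_iso_comp (is_iso_fwd (cons_iso F a _)).
apply: is_iso_comp (is_iso_tmap (is_iso_id _) IH).
apply: is_iso_comp (is_iso_bwd _).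
exact: is_iso_tmap (is_iso_bwd (cons_iso F a s)) (is_iso_id _).
Qed.

Lemma is_iso_flatten_can A (F : A -> C) ss : is_iso (flatten_can F ss).
Proof.
elim: ss => [|s ss IH]; first exact: is_iso_id.
apply: is_iso_comp (is_iso_cat_can F _ _).
apply: is_iso_comp (is_iso_tmap (is_iso_id _) IH).
exact: is_iso_bwd (cons_iso (tens F) s ss).
Qed.

Lemma tens_map_diag A (F G H : A -> C) (q : forall a, hom (G a) (H a))
    (p : forall a, hom (F a) (G a)) s :
  tens_map (pw_diag q s : homs G H s s) ∘ tens_map (pw_diag p s : homs F G s s)
  = tens_map (pw_diag (fun a => q a ∘ p a) s : homs F H s s).
Proof.
by rewrite tens_map_comp; congr tens_map; elim: s => //= a s IH; congr (_, _).
Qed.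

Lemma tens_map_graph A B (h : A -> B) (F G : A -> C) (H : B -> C)
    (q : forall a, hom (G a) (H (h a))) (p : forall a, hom (F a) (G a)) s :
  tens_map (pw_graph q s : homs G H s (map h s))
    ∘ tens_map (pw_diag p s : homs F G s s)
  = tens_map (pw_graph (fun a => q a ∘ p a) s : homs F H s (map h s)).
Proof.
by rewrite tens_map_comp; congr tens_map; elim: s => //= a s IH; congr (_, _).
Qed.

Lemma tens_map_diag_graph A B (h : A -> B) (F : A -> C) (G H : B -> C)
    (q : forall b, hom (G b) (H b)) (p : forall a, hom (F a) (G (h a))) s :
  tens_map (pw_diag q (map h s) : homs G H _ _)
    ∘ tens_map (pw_graph p s : homs F G s (map h s))
  = tens_map (pw_graph (fun a => q (h a) ∘ p a) s : homs F H s (map h s)).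
Proof.
by rewrite tens_map_comp; congr tens_map; elim: s => //= a s IH; congr (_, _).
Qed.

Lemma eq_tens_map_graph A B (h : A -> B) (F : A -> C) (G : B -> C)
    (p q : forall a, hom (F a) (G (h a))) s :
  (forall a, p a = q a) ->
  tens_map (pw_graph p s : homs F G s (map h s))
  = tens_map (pw_graph q s : homs F G s (map h s)).
Proof. by move=> e; congr tens_map; elim: s => //= a s ->; rewrite e. Qed.

Hypothesis htensor : preserves_reflexive_coequalizers (tensor C).

(** Sections and coequalizers in the product category are formed componentwise, so preservation by
    the tensor product as a functor on pairs applies to both variables at once. *)
Lemma tmap_coequalizer (X Y Q X' Y' Q' : C) (f g : hom X Y) (q : hom Y Q)
    (f' g' : hom X' Y') (q' : hom Y' Q') :
  reflexive_pair f g -> is_coequalizer f g q ->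
  reflexive_pair f' g' -> is_coequalizer f' g' q' ->
  is_coequalizer (f ⊠ f') (g ⊠ g') (q ⊠ q').
Proof.
move=> [s [fs gs]] [qE qU] [s' [fs' gs']] [qE' qU'].
apply: (htensor (X := (X, X')) (Y := (Y, Y')) (Q := (Q, Q'))
  (f := (f, f')) (g := (g, g')) (q := (q, q'))).
  exists (s, s').
  by split; [exact: (f_equal2 pair fs fs')|exact: (f_equal2 pair gs gs')].
split=> [|[Z Z'] [h h'] [/= hE hE']]; first by congr (_, _).
have [k [kE kU]] := qU _ _ hE; have [k' [kE' kU']] := qU' _ _ hE'.
exists (k, k'); split=> [|[l l'] [lE lE']]; first by congr (_, _).
by congr (_, _); [exact: kU|exact: kU'].
Qed.

Lemma tens_reflexive A (F G : A -> C) (p q : forall a, hom (F a) (G a)) s :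
  (forall a, reflexive_pair (p a) (q a)) ->
  reflexive_pair (tens_map (pw_diag p s : homs F G s s))
    (tens_map (pw_diag q s : homs F G s s)).
Proof.
(* A one-element tensor product carries no unit factor, so it is a case of its own. *)
move=> r; elim: s => [|a [|b s] IH]; last 2 first.
- exact: r.
- have [i [pi qi]] := r a; have [j [pj qj]] := IH.
  by exists (i ⊠ j); split; rewrite /= tmap_comp ?pi ?pj ?qi ?qj tmap_id.
by exists (id1 _); rewrite comp_idl.
Qed.

(** Induction with [tmap_coequalizer]. The reindexing [h] lets the quotients form the sequence
    [map h s], as the codomains of universal maps do. *)
Lemma tens_coequalizer A B (h : A -> B) (F G : A -> C) (H : B -> C)
    (p q : forall a, hom (F a) (G a)) (c : forall a, hom (G a) (H (h a))) s :
  (forall a, reflexive_pair (p a) (q a)) ->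
  (forall a, is_coequalizer (p a) (q a) (c a)) ->
  is_coequalizer (tens_map (pw_diag p s : homs F G s s))
    (tens_map (pw_diag q s : homs F G s s))
    (tens_map (pw_graph c s : homs G H s (map h s))).
Proof.
move=> r e; elim: s => [|a [|b s] IH]; last 2 first.
- exact: e.
- exact: tmap_coequalizer (r a) (e a) (tens_reflexive (b :: s) r) IH.
(* For the empty sequence all three maps are the identity of the unit object. *)
split=> // Z k _; exists k; split=> [|l]; first exact: comp_idr.
by rewrite /= comp_idr.
Qed.
End Tensor.

(** * Iterated [phi], and the reflexive pair attached to a sequence of algebras *)

Section Multilinear.
Variables (C : monoidal_category) (T : monoidal_monad C).
Local Notation alg := (alg_cat T).
Local Notation car := (@car C T).

Lemma phis_eta A (F : A -> C) s :
  phis T F s ∘ tens_map (pw_diag (fun a => eta T (F a)) s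
      : homs F (fun a => T (F a)) s s)
  = eta T (tens F s).
Proof.
elim: s => [|a [|b s] IH].
- by rewrite /= comp_idr eta_phi0.
- by rewrite /= comp_idl.
by rewrite -eta_phi -IH /= -!compA tmap_comp comp_idl.
Qed.

(** Iterates the axiom [mu_phi]; the naturality of [phi] moves the inner [phis] past the outer
    one. *)
Lemma phis_mu A (F : A -> C) s :
  phis T F s ∘ tens_map (pw_diag (fun a => mu T (F a)) s
      : homs (fun a => T (T (F a))) (fun a => T (F a)) s s)
  = mu T (tens F s) ∘ fmap T (phis T F s) ∘ phis T (fun a => T (F a)) s.
Proof.
elim: s => [|a [|b s] IH].
- by rewrite [LHS]comp_idr; exact: mu_phi0.
- by rewrite /= fmap_id comp_idl !comp_idr.
set s' := b :: s in IH *.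
rewrite -[phis T F (a :: s')]/(phi T _ _ ∘ (id1 _ ⊠ phis T F s')).
rewrite -[phis T _ (a :: s')]/(phi T _ _
  ∘ (id1 _ ⊠ phis T (fun a => T (F a)) s')).
rewrite -[tens_map _]/(mu T (F a) ⊠ tens_map (pw_diag (fun a => mu T (F a)) s'
   : homs (fun a => T (T (F a))) (fun a => T (F a)) s' s')).
rewrite -!compA tmap_comp comp_idl IH fmap_comp -!compA.
rewrite (comp_reA _ (esym (phi_nat _ _ _))) fmap_id tmap_comp comp_idl.
rewrite -[mu T (F a)]comp_idr -tmap_comp (comp_reA1 _ (mu_phi _ _ _)).
by rewrite -!compA.
Qed.

(* The algebra morphism [T (⊗ V) -> W] extending [f]. *)
Definition extend (X : C) (W : alg) (f : hom X (car W)) : hom (T X) (car W) :=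
  str W ∘ fmap T f.

Lemma extend_eta X (W : alg) (f : hom X (car W)) : extend f ∘ eta T X = f.
Proof. by rewrite /extend -compA -eta_nat compA str_eta comp_idl. Qed.

Lemma extend_mu X (W : alg) (f : hom X (car W)) :
  extend f ∘ mu T X = str W ∘ fmap T (extend f).
Proof.
by rewrite /extend -compA -mu_nat fmap_comp !compA str_mu.
Qed.

Lemma extend_comp X Y (W : alg) (f : hom Y (car W)) (g : hom X Y) :
  extend (f ∘ g) = extend f ∘ fmap T g.
Proof. by rewrite /extend fmap_comp compA. Qed.

Lemma extend_map_of X (V W : alg) (g : hom V W) (f : hom X (car V)) :
  extend (map_of g ∘ f) = map_of g ∘ extend f.
Proof. by rewrite /extend fmap_comp !compA map_ofP. Qed.

(** The morphism of free algebras extending [eta ∘ phis]. Together with [mlin_r] it forms the pair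
    whose coequalizer classifies multilinear maps. *)
Definition mlin_l (Vs : seq alg) :
    hom (T (tens (fun V => T (car V)) Vs)) (T (tens car Vs)) :=
  mu T _ ∘ fmap T (phis T car Vs).

Definition mlin_r (Vs : seq alg) :
    hom (T (tens (fun V => T (car V)) Vs)) (T (tens car Vs)) :=
  fmap T (tens_map (strs Vs)).

(** The common section is [T] of the tensor product of units: [phis_eta] and a monad law cancel it
    against [mlin_l], the unit laws of the algebras against [mlin_r]. *)
Lemma mlin_reflexive Vs : reflexive_pair (mlin_l Vs) (mlin_r Vs).
Proof.
exists (fmap T (tens_map (pw_diag (fun V : alg => eta T (car V)) Vs
  : homs car (fun V => T (car V)) Vs Vs))); split.
  by rewrite /mlin_l -compA -fmap_comp phis_eta mu_etar.
rewrite /mlin_r -fmap_comp tens_map_diag tens_map_id ?fmap_id // => V.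
exact: str_eta.
Qed.

(** With [mlin_r_mu], this makes the pair consist of morphisms of free algebras, so that the free
    action can descend to a coequalizer. *)
Lemma mlin_l_mu Vs : mu T _ ∘ fmap T (mlin_l Vs) = mlin_l Vs ∘ mu T _.
Proof.
by rewrite /mlin_l fmap_comp compA mu_assoc -!compA mu_nat.
Qed.

Lemma mlin_r_mu Vs : mu T _ ∘ fmap T (mlin_r Vs) = mlin_r Vs ∘ mu T _.
Proof. exact: mu_nat. Qed.

Lemma multilinear_extend Vs (W : alg) (f : hom (tens car Vs) (car W)) :
  multilinear f -> extend f ∘ mlin_l Vs = extend f ∘ mlin_r Vs.
Proof.
move=> fM; rewrite /mlin_l /mlin_r -extend_comp -fM compA extend_mu.
by rewrite [in RHS]/extend [in RHS]fmap_comp compA.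
Qed.

(** * Universal multilinear maps as coequalizers in the base category *)

Hypothesis hT : preserves_reflexive_coequalizers T.

Section Coequalizer.
Variables (Vs : seq alg) (Q : C) (c : hom (T (tens car Vs)) Q).
Hypothesis cP : is_coequalizer (mlin_l Vs) (mlin_r Vs) c.

Lemma coequalizer_str : exists t : hom (T Q) Q, t ∘ fmap T c = c ∘ mu T _.
Proof.
have [|t [tE _]] := (hT (mlin_reflexive Vs) cP).2 _ (c ∘ mu T _); last by exists t.
by rewrite -[LHS]compA mlin_l_mu compA cP.1 -!compA mlin_r_mu.
Qed.

(** The descended action [t] makes [Q] an algebra, since its laws can be tested after the
    epimorphisms [c] and [T (T c)]. The universal map is [c ∘ eta], whose extension is [c] again. *)
Lemma coequalizer_universal :
  exists (U : alg) (u : hom (tens car Vs) (Defs.car U)),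
    universal u /\ is_coequalizer (mlin_l Vs) (mlin_r Vs) (extend u).
Proof.
have [t tE] := coequalizer_str.
have cT_epi := coequalizer_epi (hT (mlin_reflexive Vs) cP).
have tR := reflexive_pair_fmap T (mlin_reflexive Vs).
have cTT_epi := fun Z a b => coequalizer_epi (Z := Z) (a := a) (b := b)
  (hT tR (hT (mlin_reflexive Vs) cP)).
have tU : t ∘ eta T Q = id1 Q.
  apply: (coequalizer_epi cP).
  by rewrite -compA eta_nat compA tE -compA mu_etal comp_idl comp_idr.
have tM : t ∘ fmap T t = t ∘ mu T Q.
  apply: cTT_epi.
  rewrite -!compA -fmap_comp tE fmap_comp mu_nat !compA tE -!compA.
  by rewrite mu_assoc.
pose U : alg := Algebra tU tM.
pose u : hom (tens car Vs) (Defs.car U) := c ∘ eta T _.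
have uE : extend u = c.
  by rewrite /extend /u fmap_comp compA tE -compA mu_etar comp_idr.
exists U, u; split; last by rewrite uE.
split=> [|W f fM].
  (* Multilinearity of [u] is the equation [c ∘ mlin_l = c ∘ mlin_r] precomposed with [eta]. *)
  rewrite /multilinear -[str U ∘ _]/(extend u) uE /u.
  rewrite -compA eta_nat compA -[fmap T _]/(mlin_r Vs) -cP.1 /mlin_l.
  by rewrite -!compA -eta_nat (comp_reA1 _ (mu_etal _ _)) comp_idl.
have [g [gE gU]] := cP.2 _ _ (multilinear_extend fM).
(* The factorization in the base category is a morphism of algebras, as seen after the epimorphism
   [T c]. *)
have gP : g ∘ str U = str W ∘ fmap T g.
  apply: cT_epi.
  by rewrite -!compA tE compA -fmap_comp gE extend_mu.
exists (AlgHom gP : hom U W); split.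
  by rewrite /= /u compA gE extend_eta.
move=> h hE; apply: alg_hom_inj; rewrite /=; apply: gU.
by rewrite hE extend_map_of uE.
Qed.
End Coequalizer.

Lemma universal_is_iso Vs (U U' : alg) (u : hom (tens car Vs) (Defs.car U))
    (u' : hom (tens car Vs) (Defs.car U')) (g : hom U U') :
  universal u -> universal u' -> u' = map_of g ∘ u -> is_iso g.
Proof.
move=> [uM uU] [uM' uU'] gE.
have [h [/= hE _]] := uU' _ _ uM.
have [i [_ iU]] := uU _ _ uM; have [i' [_ iU']] := uU' _ _ uM'.
exists h; split.
  by rewrite -(iU (id1 _)) ?(iU (h ∘ g)) //= ?comp_idl // -compA -gE.
by rewrite -(iU' (id1 _)) ?(iU' (g ∘ h)) //= ?comp_idl // -compA -hE.
Qed.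

Hypothesis hC : has_reflexive_coequalizers C.

Lemma universal_exists (Vs : seq alg) :
  exists (U : alg) (u : hom (tens car Vs) (Defs.car U)),
    universal u /\ is_coequalizer (mlin_l Vs) (mlin_r Vs) (extend u).
Proof.
by have [Q [c cP]] := hC (mlin_reflexive Vs); exact: coequalizer_universal cP.
Qed.

(** Any universal map differs by an isomorphism from the one built out of a coequalizer, and the
    coequalizer property transports along it. *)
Lemma universal_coequalizer Vs (U : alg) (u : hom (tens car Vs) (Defs.car U)) :
  universal u -> is_coequalizer (mlin_l Vs) (mlin_r Vs) (extend u).
Proof.
move=> uP; have [U' [u' [uP' cP]]] := universal_exists Vs.
have [g [/= gE _]] := uP'.2 _ _ uP.1.
rewrite gE extend_map_of; apply: coequalizer_iso cP.
have [h [hK hK']] := universal_is_iso uP' uP gE.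
by exists (map_of h); rewrite -!map_of_comp hK hK'.
Qed.

(** * Multilinear maps on tensor products of free algebras *)

(* The multilinear map on the free algebras [T (X a)] corresponding to [f]. *)
Definition mextend A (X : A -> C) s (W : alg) (f : hom (tens X s) (Defs.car W)) :
    hom (tens (fun a => T (X a)) s) (Defs.car W) :=
  extend f ∘ phis T X s.

Lemma mextend_eta A (X : A -> C) s (W : alg) (f : hom (tens X s) (Defs.car W)) :
  mextend f ∘ tens_map (pw_diag (fun a => eta T (X a)) s
    : homs X (fun a => T (X a)) s s) = f.
Proof. by rewrite /mextend -compA phis_eta extend_eta. Qed.

(** This is the multilinearity of [mextend f] for the free actions [mu]. *)
Lemma mextend_mu A (X : A -> C) s (W : alg) (f : hom (tens X s) (Defs.car W)) :
  mextend f ∘ tens_map (pw_diag (fun a => mu T (X a)) s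
    : homs (fun a => T (T (X a))) (fun a => T (X a)) s s)
  = mextend (mextend f).
Proof.
by rewrite /mextend -compA phis_mu extend_comp !compA extend_mu.
Qed.

Lemma mextend_tens_map A B (X : A -> C) (Y : B -> C) s t
    (fs : homs X Y s t) (W : alg) (f : hom (tens Y t) (Defs.car W)) :
  mextend f ∘ tens_map (pw_map (fun a b (g : hom (X a) (Y b)) => fmap T g) fs
    : homs (fun a => T (X a)) (fun b => T (Y b)) s t)
  = mextend (f ∘ tens_map fs).
Proof. by rewrite /mextend extend_comp -!compA phis_nat. Qed.

Lemma mextend_diag A (X Y : A -> C) (g : forall a, hom (X a) (Y a)) s (W : alg)
    (f : hom (tens Y s) (Defs.car W)) :
  mextend f ∘ tens_map (pw_diag (fun a => fmap T (g a)) s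
    : homs (fun a => T (X a)) (fun a => T (Y a)) s s)
  = mextend (f ∘ tens_map (pw_diag g s : homs X Y s s)).
Proof.
rewrite -mextend_tens_map; congr (_ ∘ tens_map _).
by elim: s {f} => //= a s ->.
Qed.

Lemma mextend_graph A B (h : A -> B) (X : A -> C) (Y : B -> C)
    (g : forall a, hom (X a) (Y (h a))) s (W : alg)
    (f : hom (tens Y (map h s)) (Defs.car W)) :
  mextend f ∘ tens_map (pw_graph (fun a => fmap T (g a)) s
    : homs (fun a => T (X a)) (fun b => T (Y b)) s (map h s))
  = mextend (f ∘ tens_map (pw_graph g s : homs X Y s (map h s))).
Proof.
rewrite -mextend_tens_map; congr (_ ∘ tens_map _).
by elim: s {f} => //= a s ->.
Qed.

(** Each [extend (g a)] is an action after [T (g a)], and multilinearity pulls the actions out of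
    [f]. *)
Lemma multilinear_graph A (h : A -> alg) (X : A -> C)
    (g : forall a, hom (X a) (Defs.car (h a))) s (W : alg)
    (f : hom (tens car (map h s)) (Defs.car W)) : multilinear f ->
  f ∘ tens_map (pw_graph (fun a => extend (g a)) s
    : homs (fun a => T (X a)) car s (map h s))
  = mextend (f ∘ tens_map (pw_graph g s : homs X car s (map h s))).
Proof.
move=> fM; rewrite -mextend_graph /mextend fM -compA.
by rewrite tens_map_diag_graph.
Qed.

Lemma flatten_can_strs (Vss : seq (seq alg)) :
  flatten_can car Vss ∘ tens_map (strs (flatten Vss))
  = tens_map (pw_diag (fun Vs => tens_map (strs Vs)) Vss
      : homs (tens (fun V => T (car V))) (tens car) Vss Vss)
    ∘ flatten_can (fun V => T (car V)) Vss.
Proof.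
have -> : strs (flatten Vss) = pw_flatten (pw_diag (@strs C T) Vss).
  elim: Vss => //= Vs Vss <-; rewrite /strs.
  by elim: Vs => //= V Vs ->.
rewrite flatten_can_nat; congr (tens_map _ ∘ _).
by elim: Vss => //= Vs Vss ->.
Qed.

(** Both sides are [mextend] of a map: of [mextend f] after the inner [phis] on the left, of [f]
    after the inner actions on the right. By [phis_flatten], these two maps agree after
    [flatten_can] exactly by multilinearity on the concatenated sequence. *)
Lemma mextend_mlin (Vss : seq (seq alg)) (W : alg)
    (f : hom (tens (tens car) Vss) (Defs.car W)) :
  multilinear (f ∘ flatten_can car Vss) ->
  mextend f ∘ tens_map (pw_diag mlin_l Vss : homs _ _ Vss Vss)
  = mextend f ∘ tens_map (pw_diag mlin_r Vss : homs _ _ Vss Vss).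
Proof.
move=> fM; rewrite mextend_diag -tens_map_diag compA mextend_mu mextend_diag.
congr mextend.
have [k [_ kK]] := is_iso_flatten_can (fun V => T (car V)) Vss.
rewrite -[LHS]comp_idr -[RHS]comp_idr -kK !compA; congr (_ ∘ _).
rewrite -[RHS]compA -flatten_can_strs compA -fM /mextend -!compA.
by rewrite fmap_comp -!compA phis_flatten -!compA.
Qed.

(** * Composites of universal maps, and invertibility of [alpha] *)

Section Composite.
Hypothesis htensor : preserves_reflexive_coequalizers (tensor C).
Variable u : universal_choice T.

Lemma umap_flatten_universal (Vss : seq (seq alg)) :
  universal (umap u (map (uobj u) Vss) ∘ tens_map (umaps u Vss)
    ∘ flatten_can car Vss).
Proof.
split=> [|W f fM]; first exact: alpha_subproof.
have cP Vs := universal_coequalizer (umapP u Vs).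
have tcP := tens_coequalizer (h := uobj u) (H := car) htensor Vss mlin_reflexive cP.
have tTP := tens_coequalizer (h := uobj u) (H := fun V => T (car V)) htensor Vss
  (fun Vs => reflexive_pair_fmap T (mlin_reflexive Vs))
  (fun Vs => hT (mlin_reflexive Vs) (cP Vs)).
have [k [kK kK']] := is_iso_flatten_can car Vss.
have fE : f ∘ k ∘ flatten_can car Vss = f by rewrite -compA kK comp_idr.
(* Here [f ∘ k] is [f] rebracketed along the nested sequences; [g] is its descent to the codomains
   of the inner universal maps. *)
have [|g [gE _]] := tcP.2 _ (mextend (f ∘ k)).
  by apply: mextend_mlin; rewrite fE.
have gM : @multilinear C T (map (uobj u) Vss) W g.
  rewrite /multilinear; apply: (coequalizer_epi tTP).
  rewrite -[str W ∘ _ ∘ _]/(mextend g) mextend_graph gE.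
  (* The equation descends because [⊗ T û_i] is a coequalizer too. *)
  rewrite -mextend_mu -gE -!compA tens_map_diag_graph tens_map_graph.
  congr (_ ∘ _); apply: eq_tens_map_graph => Vs.
  by rewrite extend_mu.
(* Restricting along [eta] recovers the inner universal maps from their extensions, and [f ∘ k] from
   [mextend (f ∘ k)]. *)
have umE : tens_map (umaps u Vss)
  = tens_map (pw_graph (fun Vs => extend (umap u Vs)) Vss
    : homs (fun Vs => T (tens car Vs)) car Vss (map (uobj u) Vss))
  ∘ tens_map (pw_diag (fun Vs => eta T (tens car Vs)) Vss : homs _ _ Vss Vss).
  rewrite tens_map_graph; apply: eq_tens_map_graph => Vs.
  by rewrite extend_eta.
have [a [/= aE aU]] := (umapP u (map (uobj u) Vss)).2 _ _ gM.
exists a; split.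
  by rewrite umE !compA -aE gE mextend_eta fE.
(* Uniqueness: any competitor [b] yields a multilinear map that agrees with [g] after the tensor
   product of the extended universal maps, an epimorphism. *)
move=> b bE; apply: aU; apply: (coequalizer_epi tcP).
rewrite gE multilinear_graph; last exact: multilinear_comp (umapP u _).1.
congr mextend.
by rewrite bE -!compA kK' comp_idr.
Qed.

Lemma phi_structure_monoidal : is_monoidal (phi_structure u).
Proof.
split=> [|Vss]; first exact: phi_structure_normal.
apply: (universal_is_iso (umapP u (flatten Vss)) (umap_flatten_universal Vss)).
by rewrite phi_alphaE.
Qed.
End Composite.
End Multilinear.

Theorem theorem3p14 (C : monoidal_category) (T : monoidal_monad C)
    (hC : has_reflexive_coequalizers C)
    (htensor : preserves_reflexive_coequalizers (tensor C))
    (hT : preserves_reflexive_coequalizers T) :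
  (forall Vs : seq (alg_cat T), exists (U : alg_cat T)
     (u : hom (tens (@car C T) Vs) (car U)), universal u) /\
  (forall u : universal_choice T, is_monoidal (phi_structure u)).
Proof.
split=> [Vs|u]; last exact: phi_structure_monoidal.
by have [U [u [uP _]]] := universal_exists hT hC Vs; exists U, u.
Qed.
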